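(* Let $k\ge 5$ be an integer and $b_0\in(0,\frac12)$ a real number. Put $$\tau_0=\left(\frac{b_0}{2}\right)^{-\frac{b_0}{2}}\left(1-\frac{b_0}{2}\right)^{-\left(1-\frac{b_0}{2}\right)},\qquad \tau_1=b_0^{-b_0}(1-b_0)^{-(1-b_0)}.$$ Let $$\mathcal{C}=\left\{c'\in[\tau_0,\tau_1]:\ k\ge\left\lceil\frac{2\ln\tau_1}{\ln c'-\ln\tau_0}\right\rceil\right\},$$ and put $c=\inf\mathcal{C}$ if $\mathcal{C}\ne\emptyset$ and $c=\tau_1$ otherwise. Then $\zeta_{\rm clique}(k)\ge \frac{\tau_1}{c}$.
   Context: A distance graph in $\mathbb{R}^n$ is a graph $G=(V,E)$ with $V\subseteq\mathbb{R}^n$ and, for some real $a>0$, $E\subseteq\{\{x,y\}: x,y\in V,\ |x-y|=a\}$ (Euclidean norm). $\chi(G)$ is the chromatic number and $\omega(G)$ the clique number. For an integer $k$, $\zeta_{\rm clique}(k)$ is the supremum of all real $\zeta$ for which there exists a function $\delta(n)\to 0$ ($n\to\infty$) such that for every $n$ there is a distance graph $G$ in $\mathbb{R}^n$ with $\omega(G)<k$ and $\chi(G)\ge(\zeta+\delta(n))^n$. *)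

(* Defs.v *)
From mathcomp Require Import all_boot all_order all_algebra.
From mathcomp Require Import all_classical all_reals all_analysis.

Set Implicit Arguments.
Unset Strict Implicit.
Unset Printing Implicit Defensive.

Import Order.TTheory GRing.Theory Num.Theory.
Import numFieldNormedType.Exports.

Local Open Scope classical_set_scope.
Local Open Scope ring_scope.

(* A simple graph, possibly infinite, whose vertices form a set in [T]. *)
Record graph (T : Type) := Graph {
  vertices : set T;
  adj : T -> T -> Prop;
  adj_sym : forall x y, adj x y -> adj y x;
  adj_irrefl : forall x, ~ adj x x;
  adj_vertices : forall x y, adj x y -> vertices x /\ vertices y
}.

(* Colours are natural numbers rather than elements of ['I_m], and values off
   the vertex set are ignored, so that the empty graph is 0-colourable. *)
Definition colorable (T : Type) (G : graph T) (m : nat) : Prop :=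
  exists f : T -> nat,
    (forall x, vertices G x -> (f x < m)%N) /\
    (forall x y, adj G x y -> f x <> f y).

Definition clique (T : Type) (G : graph T) (A : set T) : Prop :=
  A `<=` vertices G /\ (forall x y, A x -> A y -> x <> y -> adj G x y).

(* Both invariants are extended reals: +oo when no finite colouring exists,
   respectively when there are arbitrarily large finite cliques. *)
Definition chromatic_number (R : realType) (T : Type) (G : graph T) : \bar R :=
  ereal_inf [set (m%:R)%:E | m in [set m : nat | colorable G m]].

Definition clique_number (R : realType) (T : Type) (G : graph T) : \bar R :=
  ereal_sup [set (m%:R)%:E | m in
    [set m : nat | exists A : set T, clique G A /\ (A #= `I_m)%card]].

(* The library norm on ['rV[R]_n] is the sup norm. *)
Definition eucl_norm (R : realType) (n : nat) (x : 'rV[R]_n) : R :=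
  Num.sqrt (\sum_(i < n) (x ord0 i) ^+ 2).

Definition distance_graph (R : realType) (n : nat) (G : graph 'rV[R]_n) : Prop :=
  exists a : R, 0 < a /\ (forall x y, adj G x y -> eucl_norm (x - y) = a).

Definition zeta_clique (R : realType) (k : int) : \bar R :=
  ereal_sup [set zeta%:E | zeta in [set zeta : R |
    exists delta : nat -> R, delta @ \oo --> (0 : R) /\
      forall n : nat, exists G : graph 'rV[R]_n,
        [/\ distance_graph G,
            (clique_number R G < (k%:~R)%:E)%E &
            (((zeta + delta n) ^+ n)%:E <= chromatic_number R G)%E]]].

Definition tau0 (R : realType) (b0 : R) : R :=
  (b0 / 2) `^ (- (b0 / 2)) * (1 - b0 / 2) `^ (- (1 - b0 / 2)).

Definition tau1 (R : realType) (b0 : R) : R :=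
  b0 `^ (- b0) * (1 - b0) `^ (- (1 - b0)).

(* The quotient is undefined (infinite) at [c' = tau0 b0], so that point is not
   in the set; the condition [ln c' - ln (tau0 b0) != 0] is needed because
   division by zero returns 0 here. *)
Definition c_set (R : realType) (k : int) (b0 : R) : set R :=
  [set c' : R | [/\ tau0 b0 <= c' <= tau1 b0,
    ln c' - ln (tau0 b0) != 0 &
    Num.ceil (2 * ln (tau1 b0) / (ln c' - ln (tau0 b0))) <= k]].

Definition c_opt (R : realType) (k : int) (b0 : R) : R :=
  if `[< c_set k b0 !=set0 >] then inf (c_set k b0) else tau1 b0.

(* Main.v *)
Require Import Defs.
From mathcomp Require Import all_boot all_order all_algebra.
From mathcomp Require Import all_classical all_reals all_analysis.
From mathcomp Require Import ring lra zify.

Import Order.TTheory GRing.Theory Num.Theory.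
Import numFieldNormedType.Exports.

Local Open Scope ring_scope.

(* For a prime power q close to b0 n / 2, join two (2q-1)-subsets of [n] when
   they meet in q-1 points; indicator vectors make this a distance graph.  It has
   about tau1^n vertices, and by the Frankl-Wilson argument its independent sets
   have at most 'C(n, q-1), about tau0^n, elements.  Hence, by Turan, every set of
   m = c^n vertices spans about m^2 / tau0^n edges, and keeping each edge with
   probability about (tau0 / c)^n destroys all independent sets of size m.  The
   expected number of k-cliques that survive is smaller than the number of
   vertices as soon as tau1^2 (tau0 / c)^k < 1; deleting one vertex from each
   leaves half of the vertices and a chromatic number about (tau1 / c)^n.

   A suitable q exists for all large n because prime powers are multiplicatively
   dense.  This is Erdos' consequence of Selberg's formula
     psi(x) ln x + sum_(j <= x) Lambda(j) psi(x / j) = 2 x ln x + O(x):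
   if (x, l x] is almost free of prime powers, then (x / j, l x / j] has density
   close to 2, the largest possible, for most j.  Two such intervals that overlap
   form a longer interval of density 2, and applying the formula to it gives an
   almost empty interval of a ratio larger than l; iterating contradicts
   Mertens' theorem. *)

(** * Divisor sums and the Moebius function *)

(** The growth rate is exponential in n, so a q that misses b0 n / 2 by a constant factor would
    change the base [tau1] itself. Bertrand's postulate or Chebyshev's bounds are therefore too
    weak: the quotient of q by b0 n / 2 must tend to 1. This is the only reason for the analytic
    number theory. Prime powers serve as well as primes, because the linear algebra only needs 'C(s,
    q-1) to vanish mod p for every s < 2q-1 other than q-1, and not at s = 2q-1; so the von Mangoldt
    function is used throughout and higher powers are never split off. The approximation is
    one-sided, q <= b0 n / 2: the bound on independent sets is then never lost, and only the number
    of vertices pays for a q that is too small. All losses (the deviation of q, polynomial factors,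
    rounding) are absorbed by working with a c' strictly above the infimum c and a z strictly below
    [tau1] / c'. *)

Section DivisorSums.
Context {V : nmodType}.

Lemma sum_multiples (d N : nat) (g : nat -> V) : (0 < d)%N ->
  \sum_(1 <= j < N.+1 | (d %| j)%N) g j
  = \sum_(1 <= e < (N %/ d).+1) g (d * e)%N.
Proof.
move=> d0; elim: N => [|N IH]; first by rewrite div0n !big_nil.
rewrite big_mkcond big_nat_recr //= -big_mkcond /= {}IH divnS //.
case: ifP => dN; last by rewrite add0n addr0.
rewrite add1n [RHS]big_nat_recr //=; congr (_ + g _).
have /dvdnP[k hk] := dN; rewrite hk mulnC; congr (_ * _)%N.
by move: (divnS N d0); rewrite dN hk mulnK // add1n.
Qed.

(** A factorization j = d e is encoded by d and j %/ d. With [sum_hyperbola] this turns summed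
    Dirichlet convolutions into sums over the region d e <= N, in either order. *)
Lemma sum_divisors (N : nat) (f : nat -> nat -> V) :
  \sum_(1 <= j < N.+1) \sum_(1 <= d < N.+1 | (d %| j)%N) f d (j %/ d)%N
  = \sum_(1 <= d < N.+1) \sum_(1 <= e < (N %/ d).+1) f d e.
Proof.
under eq_bigr do rewrite big_mkcond.
rewrite exchange_big /=; apply: eq_big_nat => d /andP[d0 _].
rewrite -big_mkcond (sum_multiples d N (fun j => f d (j %/ d)%N)) //.
by apply: eq_bigr => e _; rewrite mulKn.
Qed.

Lemma sum_hyperbola (N : nat) (f : nat -> nat -> V) :
  \sum_(1 <= d < N.+1) \sum_(1 <= e < (N %/ d).+1) f d e
  = \sum_(1 <= e < N.+1) \sum_(1 <= d < (N %/ e).+1) f d e.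
Proof.
have E (h : nat -> nat -> V) (d : nat) : (0 < d)%N ->
    \sum_(1 <= e < (N %/ d).+1) h d e
    = \sum_(1 <= e < N.+1 | (d * e <= N)%N) h d e.
  move=> d0; rewrite (@big_cat_nat _ _ _ (N %/ d).+1 1 N.+1) //=; last first.
    by rewrite ltnS leq_div.
  rewrite [X in _ = _ + X]big_nat_cond [X in _ = _ + X]big1 ?addr0; last first.
    move=> e /andP[/andP[h1 _]]; rewrite mulnC -leq_divRL // => h2.
    by rewrite ltnNge h2 in h1.
  rewrite big_nat_cond [RHS]big_nat_cond; apply: eq_bigl => e.
  by rewrite andbT mulnC -leq_divRL // -andbA -ltnS andbb.
transitivity (\sum_(1 <= d < N.+1) \sum_(1 <= e < N.+1 | (d * e <= N)%N) f d e).
  by apply: eq_big_nat => d /andP[d0 _]; exact: E.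
under eq_bigr do rewrite big_mkcond.
rewrite exchange_big /=; apply: eq_big_nat => e /andP[e0 _].
rewrite -big_mkcond /= (E (fun e d => f d e)) //.
by apply: eq_bigl => d; rewrite mulnC.
Qed.

Lemma sum_dvd_nat (N m : nat) (g : nat -> V) : (0 < m <= N)%N ->
  \sum_(1 <= d < N.+1 | (d %| m)%N) g d = \sum_(1 <= d < m.+1 | (d %| m)%N) g d.
Proof.
move=> /andP[m0 mN]; rewrite (@big_cat_nat _ _ _ m.+1) //=.
rewrite [X in _ + X]big_nat_cond [X in _ + X]big1 ?addr0 // => d.
move=> /andP[/andP[h1 _]] /dvdn_leq; move=> /(_ m0) h2.
by rewrite ltnNge h2 in h1.
Qed.

End DivisorSums.

Section Moebius.

Definition moebius (n : nat) : int :=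
  if all (fun p => logn p n == 1%N) (primes n) then (-1) ^+ size (primes n)
  else 0.

Lemma moebius1 : moebius 1 = 1.
Proof. by []. Qed.

Lemma moebius_le1 (n : nat) : `|moebius n| <= 1.
Proof. by rewrite /moebius; case: ifP => _; rewrite ?normr0 // normrX normrN1 expr1n. Qed.

Lemma moebius_sqr (p d : nat) : prime p -> (p %| d)%N -> (0 < d)%N ->
  moebius (p * d) = 0.
Proof.
move=> pp pd d0; rewrite /moebius ifF //; apply/negbTE/allPn.
exists p; first by rewrite mem_primes pp muln_gt0 prime_gt0 // d0 dvdn_mulr.
rewrite lognM ?(prime_gt0 pp) // (logn_prime p pp) eqxx.
have : (0 < logn p d)%N by rewrite logn_gt0 mem_primes pp d0.
by case: (logn p d).
Qed.

Lemma moebius_coprime (p d : nat) : prime p -> ~~ (p %| d)%N -> (0 < d)%N ->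
  moebius (p * d) = - moebius d.
Proof.
move=> pp pd d0; have p0 := prime_gt0 pp.
have pnd : p \notin primes d by rewrite mem_primes pp d0.
have perm : perm_eq (primes (p * d)) (p :: primes d).
  apply: uniq_perm; rewrite /= ?primes_uniq ?andbT // => q.
  by rewrite primesM // primes_prime // !inE.
rewrite /moebius (perm_all _ perm) (perm_size perm) /=.
rewrite lognM // (logn_prime p pp) eqxx (_ : logn p d = 0%N) /=; last first.
  by apply/eqP; rewrite -leqn0 leqNgt logn_gt0.
have -> : all (fun q => logn q (p * d) == 1%N) (primes d)
  = all (fun q => logn q d == 1%N) (primes d).
  apply: eq_in_all => q qd; rewrite lognM // (logn_prime q pp).
  by case: (q =P p) => [qp|//]; rewrite -qp qd in pnd.
by case: ifP; rewrite ?oppr0 // exprS mulN1r.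
Qed.

(** For a prime p dividing n, multiplication by p pairs the divisors prime to p with those that p
    divides exactly once, with opposite signs; divisors that are multiples of p^2 contribute 0. *)
Lemma sum_moebius (n : nat) : (0 < n)%N ->
  \sum_(1 <= d < n.+1 | (d %| n)%N) moebius d = (n == 1%N)%:R.
Proof.
move=> n0; case: eqP => [->|/eqP n1]; first by rewrite big_mkcond big_nat1 /= moebius1.
have pp : prime (pdiv n) by rewrite pdiv_prime // ltn_neqAle eq_sym n1.
have pn := pdiv_dvd n; set p := pdiv n in pp pn *.
have p0 := prime_gt0 pp.
rewrite (bigID (fun d => (p %| d)%N)) /=.
have -> : \sum_(1 <= d < n.+1 | (d %| n)%N && (p %| d)%N) moebius d
  = \sum_(1 <= d < (n %/ p).+1 | (d %| n %/ p)%N) moebius (p * d)%N.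
  rewrite big_mkcondl (sum_multiples p n (fun d => if (d %| n)%N then moebius d else 0)) //.
  rewrite [RHS]big_mkcond; apply: eq_bigr => d _.
  by rewrite -[in X in (_ %| X)%N](divnK pn) mulnC dvdn_pmul2r.
rewrite (bigID (fun d => (p %| d)%N)) /= big_nat_cond big1 ?add0r; last first.
  by move=> d /andP[/andP[d0 _] /andP[_ pd]]; apply: moebius_sqr.
have -> : \sum_(1 <= d < (n %/ p).+1 | (d %| n %/ p)%N && ~~ (p %| d)%N) moebius (p * d)%N
  = - \sum_(1 <= d < (n %/ p).+1 | (d %| n %/ p)%N && ~~ (p %| d)%N) moebius d.
  rewrite -sumrN big_nat_cond [RHS]big_nat_cond; apply: eq_bigr.
  by move=> d /andP[/andP[d0 _] /andP[_ pd]]; apply: moebius_coprime.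
apply/eqP; rewrite addrC subr_eq0; apply/eqP.
have np0 : (0 < n %/ p)%N by rewrite divn_gt0 // dvdn_leq.
have := @sum_dvd_nat _ n (n %/ p)%N (fun d => if ~~ (p %| d)%N then moebius d else 0).
rewrite -!big_mkcondr /= => <-; last by rewrite np0 leq_div.
apply: eq_bigl => d; case pd : (p %| d)%N; rewrite ?andbF // !andbT.
have := Gauss_dvdl (n %/ p) (_ : coprime d p); rewrite divnK // => -> //.
by rewrite coprime_sym prime_coprime // pd.
Qed.

End Moebius.

(** * Chebyshev and Mertens estimates *)

Section VonMangoldt.
Context {R : realType}.

(** At most one pair (p, i) contributes. The double sum can be exchanged with other finite sums
    without a case distinction on the shape of n. *)
Definition vonMangoldt (n : nat) : R :=
  \sum_(1 <= p < n.+1 | prime p) \sum_(1 <= i < n.+1 | (p ^ i)%N == n) ln p%:R.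

Lemma vonMangoldt_widen (B n : nat) : (0 < n <= B)%N ->
  vonMangoldt n
  = \sum_(1 <= p < B.+1 | prime p) \sum_(1 <= i < B.+1 | (p ^ i)%N == n) ln p%:R.
Proof.
move=> /andP[n0 nB]; rewrite /vonMangoldt.
have W (p : nat) : prime p -> \sum_(1 <= i < B.+1 | (p ^ i)%N == n) ln p%:R
    = \sum_(1 <= i < n.+1 | (p ^ i)%N == n) (ln p%:R : R).
  move=> pp; rewrite (@big_cat_nat _ _ _ n.+1) //= [X in _ + X]big_nat_cond.
  rewrite [X in _ + X]big1 ?addr0 // => i /andP[/andP[ni _] /eqP pin].
  by have := ltn_expl i (prime_gt1 pp); rewrite pin ltnNge (ltnW ni).
under [RHS]eq_bigr do rewrite W //.
rewrite [RHS](@big_cat_nat _ _ _ n.+1) //= [X in _ + X]big_nat_cond.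
rewrite [X in _ = _ + X]big1 ?addr0 // => p /andP[/andP[np _] _].
rewrite big_nat_cond big1 // => i /andP[/andP[i0 _] /eqP pin].
have : (p <= p ^ i)%N by rewrite -{1}(expn1 p) leq_pexp2l // (leq_trans _ np).
by rewrite pin leqNgt np.
Qed.

Lemma vonMangoldt_ge0 (n : nat) : 0 <= vonMangoldt n.
Proof.
rewrite /vonMangoldt big_nat_cond sumr_ge0 // => p /andP[/andP[p0 _] _].
by rewrite sumr_ge0 // => i _; rewrite ln_ge0 // ler1n.
Qed.

Lemma vonMangoldt_prime_power (n : nat) : vonMangoldt n != 0 ->
  exists p i : nat, [/\ prime p, (0 < i)%N & n = (p ^ i)%N].
Proof.
move=> h; apply: contrapT => H; move/eqP: h; apply.
rewrite /vonMangoldt big1 // => p pp; rewrite big_nat_cond big1 // => i.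
by move=> /andP[/andP[i0 _] /eqP E]; case: H; exists p, i.
Qed.

Lemma ln_nat_prod (s : seq nat) (P : pred nat) (f : nat -> nat) :
  (forall i, P i -> (0 < f i)%N) ->
  ln (\prod_(i <- s | P i) f i)%N%:R = \sum_(i <- s | P i) (ln (f i)%:R : R).
Proof.
(* Positivity is carried along the induction because [lnM] requires it of both factors. *)
move=> f0; pose K (x : nat) (y : R) := (0 < x)%N /\ ln x%:R = y.
suff : K (\prod_(i <- s | P i) f i)%N (\sum_(i <- s | P i) ln (f i)%:R) by case.
apply: (big_ind2 K); [by split; rewrite ?ln1| |by move=> i Pi; split; rewrite ?f0].
move=> x1 x2 y1 y2 [h1 h2] [h3 h4]; split; first by rewrite muln_gt0 h1.
by rewrite natrM lnM ?posrE ?ltr0n // h2 h4.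
Qed.

Lemma sum_vonMangoldt (m : nat) : (0 < m)%N ->
  \sum_(1 <= d < m.+1 | (d %| m)%N) vonMangoldt d = ln m%:R.
Proof.
move=> m0.
have -> : \sum_(1 <= d < m.+1 | (d %| m)%N) vonMangoldt d
  = \sum_(1 <= d < m.+1 | (d %| m)%N) \sum_(1 <= p < m.+1 | prime p)
    \sum_(1 <= i < m.+1) if (p ^ i)%N == d then ln p%:R else 0.
  rewrite big_nat_cond [RHS]big_nat_cond; apply: eq_bigr => d.
  move=> /andP[/andP[d0 dm] _]; rewrite (@vonMangoldt_widen m d) ?d0 //.
  by apply: eq_bigr => p _; rewrite big_mkcond.
rewrite exchange_big /=.
transitivity (\sum_(1 <= p < m.+1 | prime p) (logn p m)%:R * (ln p%:R : R)).
  apply: eq_bigr => p pp; rewrite exchange_big /=.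
  transitivity (\sum_(1 <= i < m.+1 | (i <= logn p m)%N) (ln p%:R : R)).
    rewrite [RHS]big_mkcond; apply: eq_big_nat => i /andP[i0 im].
    rewrite -pfactor_dvdn //; case: ifP => pm; last first.
      by rewrite big1 // => d dm; case: eqP => // pid; rewrite pid dm in pm.
    have pim : (p ^ i < m.+1)%N by rewrite ltnS dvdn_leq.
    rewrite big_mkcond (bigD1_seq (p ^ i)%N) ?iota_uniq //=; last first.
      by rewrite mem_index_iota pim expn_gt0 prime_gt0.
    rewrite pm eqxx big1 ?addr0 // => d.
    by rewrite eq_sym => /negbTE ->; case: ifP.
  have lm : (logn p m < m.+1)%N by rewrite ltnS ltnW // ltn_logl.
  rewrite (@big_cat_nat _ _ _ (logn p m).+1) //= [X in _ + X]big_nat_cond.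
  rewrite [X in _ + X]big1 ?addr0; last first.
    by move=> i /andP[/andP[h _] /(leq_trans h)]; rewrite ltnn.
  rewrite big_nat_cond (eq_bigl (fun i => (1 <= i < (logn p m).+1)%N)); last first.
    by move=> i; rewrite ltnS -andbA andbb.
  by rewrite -big_nat sumr_const_nat subSS subn0 mulr_natl.
have mE : (\prod_(0 <= p < m.+1) p ^ logn p m)%N = m.
  by rewrite -[RHS]partnT // (widen_partn _ (leqnn m)).
transitivity (ln (\prod_(0 <= p < m.+1) p ^ logn p m)%N%:R : R); last by rewrite mE.
rewrite ln_nat_prod /=; last by move=> [|p] _; rewrite ?expn_gt0 // logn0.
rewrite big_mkcond [RHS](@big_cat_nat _ _ _ 1) //= big_nat1 expn0 ?ln1.
rewrite add0r; apply: eq_big_nat => p /andP[p0 _]; case: ifP => pp.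
  by rewrite natrX lnXn ?ltr0n // mulr_natl.
by rewrite /logn pp expn0 ln1.
Qed.

Definition psi (n : nat) : R := \sum_(1 <= d < n.+1) vonMangoldt d.

Lemma psi_le (m n : nat) : (m <= n)%N -> psi m <= psi n.
Proof.
move=> mn; rewrite /psi [leRHS](@big_cat_nat _ _ _ m.+1) //=.
by rewrite lerDl sumr_ge0 // => d _; exact: vonMangoldt_ge0.
Qed.

Lemma psi0 : psi 0 = 0.
Proof. by rewrite /psi big_nil. Qed.

Lemma psi_ge0 (n : nat) : 0 <= psi n.
Proof. by rewrite -psi0 psi_le. Qed.

Lemma ln_fact (n : nat) : ln n`!%:R = \sum_(1 <= j < n.+1) (ln j%:R : R).
Proof.
rewrite fact_prod big_nat_cond ln_nat_prod; last by move=> i /andP[/andP[]].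
by rewrite -big_nat_cond.
Qed.

Lemma ln_fact_psi (n : nat) :
  ln n`!%:R = \sum_(1 <= d < n.+1) psi (n %/ d).
Proof.
rewrite ln_fact /psi -(sum_hyperbola n (fun d _ => vonMangoldt d)).
rewrite -(sum_divisors n (fun d _ => vonMangoldt d)).
apply: eq_big_nat => j /andP[j0 jn].
by rewrite (sum_dvd_nat n j) ?j0 // sum_vonMangoldt.
Qed.

Lemma ln_fact_vonMangoldt (n : nat) :
  ln n`!%:R = \sum_(1 <= d < n.+1) vonMangoldt d * (n %/ d)%:R.
Proof.
rewrite ln_fact_psi /psi -(sum_hyperbola n (fun d _ => vonMangoldt d)).
by apply: eq_bigr => d _; rewrite sumr_const_nat subSS subn0 mulr_natr.
Qed.

Lemma ln_le_sub1 (x : R) : 0 < x -> ln x <= x - 1.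
Proof. by move=> x0; have := @le_ln1Dx R (x - 1); rewrite (_ : 1 + (x - 1) = x); [apply; lra|ring]. Qed.

Lemma ln_fact_bounds (n : nat) : (0 < n)%N ->
  n%:R * ln n%:R - n%:R <= ln n`!%:R :> R /\
  ln n`!%:R <= n%:R * ln n%:R - n%:R + 1 + ln n%:R :> R.
Proof.
elim: n => [//|[|n] IH _]; first by rewrite (_ : 1`! = 1%N) // ln1; split; lra.
case: (IH isT) => {IH} lo hi; rewrite factS natrM.
have n1 : (0 : R) < n.+1%:R by rewrite ltr0n.
have n2 : (0 : R) < n.+2%:R by rewrite ltr0n.
rewrite lnM ?posrE // ?ltr0n ?fact_gt0 //.
set a : R := ln n.+1%:R in lo hi *; set b : R := ln n.+2%:R.
have E : n.+2%:R = n.+1%:R + 1 :> R by rewrite -natr1.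
have ab1 : n.+1%:R * (b - a) <= 1.
  rewrite /a /b -ln_div ?posrE //.
  have h := @ln_le_sub1 (n.+2%:R / n.+1%:R) (divr_gt0 n2 n1).
  apply: (le_trans (ler_wpM2l (ltW n1) h)).
  by rewrite E mulrBr mulrC divfK ?gt_eqF //; lra.
have ab2 : n.+2%:R * (b - a) >= 1.
  rewrite /a /b -opprB -ln_div ?posrE //.
  have h := @ln_le_sub1 (n.+1%:R / n.+2%:R) (divr_gt0 n1 n2).
  rewrite mulrN lerNr; apply: (le_trans (ler_wpM2l (ltW n2) h)).
  by rewrite mulrBr mulrC divfK ?gt_eqF // E; lra.
rewrite E in ab2 *; split; nra.
Qed.

End VonMangoldt.

Section Chebyshev.
Context {R : realType}.
Local Notation Lambda := (@vonMangoldt R).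
Local Notation psi := (@psi R).

(** With k = n./2 the right side is the sum of Lambda d times n %/ d - 2 (k %/ d). These
    coefficients are nonnegative, and at least 1 for k < d <= n. *)
Lemma psi_half (n : nat) : psi n - psi n./2 <= ln n`!%:R - 2 * ln (n./2)`!%:R.
Proof.
set k := n./2; have kn : (k <= n)%N by rewrite /k -divn2 leq_div.
have k2n : (2 * k <= n)%N by rewrite mul2n -[leqRHS](odd_double_half n) leq_addl.
rewrite !ln_fact_vonMangoldt /psi.
rewrite [X in _ - 2 * X](_ : _ = \sum_(1 <= d < n.+1) Lambda d * (k %/ d)%:R).
  2: { rewrite [RHS](@big_cat_nat _ _ _ k.+1) //= [X in _ = _ + X]big_nat_cond.
       rewrite [X in _ = _ + X]big1 ?addr0 // => d /andP[/andP[kd _] _].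
       by rewrite divn_small // mulr0. }
rewrite mulr_sumr -sumrB.
rewrite [X in X - _ <= _](@big_cat_nat _ _ _ k.+1) //= addrAC subrr add0r.
rewrite [leRHS](@big_cat_nat _ _ _ k.+1) //= -[leLHS]add0r lerD //.
  rewrite big_nat_cond sumr_ge0 // => d /andP[/andP[d0 _] _].
  have -> : Lambda d * (n %/ d)%:R - 2 * (Lambda d * (k %/ d)%:R)
    = Lambda d * ((n %/ d)%:R - (2 * (k %/ d))%:R) by rewrite natrM; ring.
  rewrite mulr_ge0 ?vonMangoldt_ge0 // subr_ge0 ler_nat leq_divRL // -mulnA.
  by rewrite (leq_trans _ k2n) // leq_mul2l /= leq_divM.
rewrite big_nat_cond [leRHS]big_nat_cond; apply: ler_sum => d.
move=> /andP[/andP[kd dn] _]; rewrite (divn_small kd) !mulr0 subr0.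
rewrite ler_peMr ?vonMangoldt_ge0 // ler1n divn_gt0 //.
exact: leq_ltn_trans kd.
Qed.

Lemma bin_le_expn2 (n k : nat) : ('C(n, k) <= 2 ^ n)%N.
Proof.
elim: n k => [|n IH] [|k]; rewrite ?bin0 ?expn_gt0 // binS expnS mul2n -addnn.
exact: leq_add.
Qed.

Lemma ln_nat_ge0 (n : nat) : 0 <= ln n%:R :> R.
Proof. by case: n => [|n]; [rewrite ln0|rewrite ln_ge0 ?ler1n]. Qed.

(** Halving induction: with k = m./2, the increment from k to m is at most the logarithm of (k+1)
    2^m, since m - k <= k + 1. Using ln 2 <= 1, the total is at most 2m + m + m/2. *)
Lemma psi_upper (n : nat) : psi n <= 4 * n%:R.
Proof.
elim/ltn_ind: n => -[|n] IH; first by rewrite psi0 mulr0.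
set m := n.+1 in IH *; set k := m./2.
have km : (k < m)%N by rewrite /k /m -divn2 ltn_Pdiv.
have k2m : (2 * k <= m)%N by rewrite mul2n -[leqRHS](odd_double_half m) leq_addl.
have mk : (m - k <= k.+1)%N.
  by rewrite leq_subLR addnS addnn -{1}(odd_double_half m) -add1n leq_add2r leq_b1.
have := psi_half m; rewrite -/k => h.
have hk := IH k km.
have lf : (m`! <= 2 ^ m * (k.+1 * (k`! * k`!)))%N.
  rewrite -(bin_fact (ltnW km)) leq_mul ?bin_le_expn2 // mulnCA leq_mul2l.
  by rewrite -factS leq_fact ?orbT.
have : ln m`!%:R <= m%:R * ln 2 + (ln k.+1%:R + 2 * ln k`!%:R) :> R.
  have -> : m%:R * ln 2 + (ln k.+1%:R + 2 * ln k`!%:R)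
     = ln (2 ^ m * (k.+1 * (k`! * k`!)))%:R :> R.
    rewrite !natrM natrX !lnM ?posrE ?mulr_gt0 ?exprn_gt0 ?ltr0n ?fact_gt0 //.
    by rewrite lnXn // mulr_natl mulr_natl mulr2n.
  by rewrite ler_ln ?posrE ?ltr0n ?ler_nat ?fact_gt0 // !muln_gt0 expn_gt0 ?fact_gt0.
have l2 : ln 2 <= 1 :> R by have := @ln_le_sub1 R 2 ltac:(lra); lra.
have lk : ln k.+1%:R <= k%:R :> R.
  by have := @ln_le_sub1 R k.+1%:R (ltr0Sn _ _); rewrite -natr1; lra.
have k2m' : 2 * k%:R <= m%:R :> R by rewrite -natrM ler_nat.
have m0 : 0 <= m%:R :> R by [].
nra.
Qed.

Lemma natr_divn_bounds (N d : nat) : (0 < d)%N ->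
  (N %/ d)%:R <= N%:R / d%:R :> R /\ N%:R / d%:R <= (N %/ d)%:R + 1 :> R.
Proof.
move=> d0; have d0' : (0 : R) < d%:R by rewrite ltr0n.
rewrite ler_pdivlMr // ler_pdivrMr // natr1 -!natrM !ler_nat.
by rewrite leq_divM ltnW // ltn_ceil.
Qed.

(** N times the sum differs from ln N! only by replacing N %/ d with N / d, an error of at most psi
    N <= 4 N. *)
Lemma mertens (N : nat) : (0 < N)%N ->
  ln N%:R - 1 <= \sum_(1 <= d < N.+1) Lambda d / d%:R <= ln N%:R + 5.
Proof.
move=> N0; have N0' : (0 : R) < N%:R by rewrite ltr0n.
have [lo hi] := @ln_fact_bounds R N N0.
set S := \sum_(_ <= _ < _) _.
have E : N%:R * S = \sum_(1 <= d < N.+1) Lambda d * (N%:R / d%:R).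
  by rewrite /S mulr_sumr; apply: eq_bigr => d _; rewrite mulrCA.
have h1 : ln N`!%:R <= N%:R * S.
  rewrite E ln_fact_vonMangoldt big_nat_cond [leRHS]big_nat_cond.
  apply: ler_sum => d /andP[/andP[d0 _] _].
  by rewrite ler_wpM2l ?vonMangoldt_ge0 //; case: (natr_divn_bounds N d).
have h2 : N%:R * S <= ln N`!%:R + psi N.
  rewrite E ln_fact_vonMangoldt /psi -big_split /= big_nat_cond [leRHS]big_nat_cond.
  apply: ler_sum => d /andP[/andP[d0 _] _].
  rewrite -[X in _ + X]mulr1 -mulrDr.
  by rewrite ler_wpM2l ?vonMangoldt_ge0 //; case: (natr_divn_bounds N d).
have h3 := psi_upper N.
have h4 := @ln_le_sub1 R N%:R N0'.
by apply/andP; split; rewrite -(ler_pM2l N0'); lra.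
Qed.

Definition harmonic_sum (n : nat) : R := \sum_(1 <= j < n.+1) j%:R^-1.

Lemma harmonic_sumS (n : nat) :
  harmonic_sum n.+1 = harmonic_sum n + n.+1%:R^-1.
Proof. by rewrite /harmonic_sum big_nat_recr. Qed.

Lemma ln_succ_bounds (n : nat) : (0 < n)%N ->
  n.+1%:R^-1 <= ln n.+1%:R - ln n%:R :> R /\ ln n.+1%:R - ln n%:R <= n%:R^-1 :> R.
Proof.
move=> n0; have n1 : (0 : R) < n%:R by rewrite ltr0n.
have n2 : (0 : R) < n.+1%:R by rewrite ltr0n.
split.
  rewrite -opprB -ln_div ?posrE // lerNr.
  have h := @ln_le_sub1 R (n%:R / n.+1%:R) (divr_gt0 n1 n2); apply: (le_trans h).
  have -> : n%:R = n.+1%:R - 1 :> R by rewrite -natr1; ring.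
  by rewrite mulrBl divff ?gt_eqF // div1r addrAC subrr add0r.
rewrite -ln_div ?posrE //; have h := @ln_le_sub1 R (n.+1%:R / n%:R) (divr_gt0 n2 n1); apply: (le_trans h).
by rewrite -natr1 mulrDl divff ?gt_eqF //; lra.
Qed.

(** The constant is the supremum of the increasing sequence H_n - ln (n+1), which stays below the
    decreasing H_n - ln n. The error 1/n matters: in Selberg's formula it is multiplied by a
    quantity of order n. *)
Lemma euler_gamma_exists : exists gamma : R, forall n : nat, (0 < n)%N ->
  0 <= harmonic_sum n - ln n%:R - gamma <= n%:R^-1.
Proof.
pose a n := harmonic_sum n - ln n%:R; pose b n := harmonic_sum n - ln n.+1%:R.
have aS n : a n.+2 <= a n.+1.
  by rewrite /a harmonic_sumS; have [] := @ln_succ_bounds n.+1 isT; set u := n.+2%:R^-1; lra.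
have bS n : b n.+1 <= b n.+2.
  by rewrite /b [harmonic_sum n.+2]harmonic_sumS; have [] := @ln_succ_bounds n.+2 isT; set u := _^-1; set v := _^-1; lra.
have am m n : (m <= n)%N -> a n.+1 <= a m.+1.
  by move/subnK <-; elim: (n - m)%N => [//|i IH]; rewrite addSn (le_trans (aS _)).
have bm m n : (m <= n)%N -> b m.+1 <= b n.+1.
  by move/subnK <-; elim: (n - m)%N => [//|i IH]; rewrite addSn (le_trans IH) ?bS.
have ba n : b n.+1 <= a n.+1.
  by rewrite /a /b lerD2l lerN2 ler_ln ?posrE ?ltr0n // ler_nat.
have bam m n : b m.+1 <= a n.+1.
  apply: le_trans (bm _ _ (leq_maxl m n)) (le_trans (ba _) _).
  exact/am/leq_maxr.
pose E := [set b n.+1 | n in [set: nat]]%classic.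
have supE : has_sup E.
  split; first by exists (b 1%N), 0%N.
  by exists (a 1%N) => _ [n _ <-].
exists (sup E) => -[//|n] _; apply/andP; split.
  rewrite subr_ge0 -/(a n.+1); apply: sup_le_ub; first by case: supE.
  by move=> _ [m _ <-].
have : b n.+1 <= sup E by apply: sup_upper_bound => //; exists n.
by rewrite /b; have [] := @ln_succ_bounds n.+1 isT; set u := _^-1; set v := _^-1; lra.
Qed.

End Chebyshev.

(** * Selberg's formula *)

Section Selberg.
Context {R : realType}.
Local Notation Lambda := (@vonMangoldt R).
Local Notation psi := (@psi R).

Lemma sum_moebius_multiples (N : nat) (g : nat -> R) : (0 < N)%N ->
  \sum_(1 <= n < N.+1) (moebius n)%:~R * \sum_(1 <= m < (N %/ n).+1) g (n * m)%N
  = g 1%N.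
Proof.
move=> N0; under eq_bigr do rewrite mulr_sumr.
rewrite -(sum_divisors N (fun n m => (moebius n)%:~R * g (n * m)%N)).
transitivity (\sum_(1 <= j < N.+1) g j * (j == 1%N)%:R).
  apply: eq_big_nat => j /andP[j0 jN].
  transitivity (\sum_(1 <= d < N.+1 | (d %| j)%N) g j * (moebius d)%:~R).
    by apply: eq_bigr => d dj; rewrite mulrC (mulnC d) divnK.
  rewrite -mulr_sumr (sum_dvd_nat N j) ?j0 //; congr (_ * _).
  have := sum_moebius j j0 => /(congr1 (fun z : int => z%:~R : R)).
  by rewrite rmorph_sum /= => ->; case: eqP.
rewrite big_nat_recl //= mulr1 big_nat_cond big1 ?addr0 // => j.
by move=> /andP[/andP[j0 _] _]; rewrite eqSS gtn_eqF ?mulr0.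
Qed.

(** The Tatuzawa-Iseki identity. Write ln (N/n) = ln (N/(nm)) + ln m: Moebius inversion reduces the
    first part to j = 1. In the second, ln m is the sum of Lambda e over e dividing m, and inversion
    along the multiples of e leaves F e. *)
Lemma iseki (N : nat) (F : nat -> R) : (0 < N)%N ->
  \sum_(1 <= n < N.+1) (moebius n)%:~R *
    (ln (N%:R / n%:R) * \sum_(1 <= m < (N %/ n).+1) F (n * m)%N)
  = F 1%N * ln N%:R + \sum_(1 <= j < N.+1) Lambda j * F j.
Proof.
move=> N0; have N0' : (0 : R) < N%:R by rewrite ltr0n.
transitivity (\sum_(1 <= n < N.+1) ((moebius n)%:~R *
    \sum_(1 <= m < (N %/ n).+1) ln (N%:R / (n * m)%:R) * F (n * m)%N +
    (moebius n)%:~R * \sum_(1 <= m < (N %/ n).+1) ln m%:R * F (n * m)%N)).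
  apply: eq_big_nat => n /andP[n0 _]; rewrite -mulrDr; congr (_ * _).
  rewrite -big_split mulr_sumr /=; apply: eq_big_nat => m /andP[m0 _].
  rewrite -mulrDl; congr (_ * _); rewrite natrM.
  have n0' : (0 : R) < n%:R by rewrite ltr0n.
  have m0' : (0 : R) < m%:R by rewrite ltr0n.
  rewrite -lnM ?posrE ?divr_gt0 ?mulr_gt0 //; congr ln.
  by rewrite invfM mulrA divfK ?gt_eqF.
rewrite big_split /=; congr (_ + _).
  rewrite (sum_moebius_multiples N (fun j => ln (N%:R / j%:R) * F j)) //.
  by rewrite divr1 mulrC.
transitivity (\sum_(1 <= n < N.+1) \sum_(1 <= e < (N %/ n).+1)
   (moebius n)%:~R * (Lambda e * \sum_(1 <= l < (N %/ n %/ e).+1) F (n * (e * l))%N)).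
  apply: eq_bigr => n _; rewrite -mulr_sumr; congr (_ * _).
  under [RHS]eq_bigr do rewrite mulr_sumr.
  rewrite -(sum_divisors (N %/ n) (fun e l => Lambda e * F (n * (e * l))%N)).
  apply: eq_big_nat => m /andP[m0 mN].
  rewrite -(@sum_vonMangoldt R m m0) mulr_suml -(sum_dvd_nat (N %/ n)) ?m0 //.
  by apply: eq_bigr => d dm; rewrite (mulnC d) divnK.
rewrite (sum_hyperbola N (fun n e => (moebius n)%:~R *
  (Lambda e * \sum_(1 <= l < (N %/ n %/ e).+1) F (n * (e * l))%N))).
apply: eq_big_nat => e /andP[e0 eN].
rewrite -[in RHS](muln1 e) -(sum_moebius_multiples (N %/ e) (fun j => F (e * j)%N)).
  by rewrite muln1 mulr_sumr; apply: eq_bigr => n _; rewrite mulrCA -!divnMA mulnC;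
     congr (_ * (_ * _)); apply: eq_bigr => l _; rewrite mulnCA.
by rewrite divn_gt0.
Qed.

(** Apply ln z <= z - 1 to the fourth root z of y. A bound by sqrt (N/n) is wanted because its sum
    over n <= N is O(N), with no logarithm. *)
Lemma ln_quadratic_bound (y : R) : 1 <= y ->
  ln y * (3 + ln y) <= 28 * Num.sqrt y.
Proof.
move=> y1; set z := Num.sqrt (Num.sqrt y).
have y0 : 0 < y by lra.
have s0 : 0 < Num.sqrt y by rewrite sqrtr_gt0.
have z0 : 0 < z by rewrite sqrtr_gt0.
have s2 : Num.sqrt y ^+ 2 = y by rewrite sqr_sqrtr // ltW.
have z2 : z ^+ 2 = Num.sqrt y by rewrite sqr_sqrtr // ltW.
have lz : ln y = 4 * ln z.
  by rewrite -[in LHS]s2 -[in LHS]z2 -exprM lnXn // mulr_natl.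
have z1 : 1 <= z by rewrite -sqrtr1 ler_wsqrtr // -sqrtr1 ler_wsqrtr.
have := ln_le_sub1 z z0; have := ln_ge0 z1; rewrite lz -z2 => h1 h2.
nra.
Qed.

Lemma sum_inv_sqrt (N : nat) :
  \sum_(1 <= n < N.+1) (Num.sqrt n%:R)^-1 <= 2 * Num.sqrt N%:R :> R.
Proof.
elim: N => [|N IH]; first by rewrite big_nil sqrtr0 mulr0.
rewrite big_nat_recr //=; set a : R := Num.sqrt N%:R in IH *; set b := Num.sqrt N.+1%:R.
have b0 : 0 < b by rewrite sqrtr_gt0 ltr0n.
have a0 : 0 <= a by rewrite sqrtr_ge0.
have a2 : a ^+ 2 = N%:R by rewrite sqr_sqrtr.
have b2 : b ^+ 2 = a ^+ 2 + 1 by rewrite a2 natr1 sqr_sqrtr.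
have : b^-1 <= 2 * b - 2 * a.
  rewrite -(ler_pM2l b0) divff ?gt_eqF //.
  have := sqr_ge0 (b - a); nra.
lra.
Qed.

Lemma selberg (N : nat) : (0 < N)%N ->
  `|psi N * ln N%:R + \sum_(1 <= j < N.+1) Lambda j * psi (N %/ j)
    - 2 * (N%:R * ln N%:R)| <= 80 * N%:R.
Proof.
move=> N0; have N0' : (0 : R) < N%:R by rewrite ltr0n.
have [g hg] := @euler_gamma_exists R.
have [g0 g1] : 0 <= g /\ g <= 1.
  by have := hg 1%N isT; rewrite /harmonic_sum big_nat1 ln1 invr1; lra.
(* The constant g + 1 cancels the linear terms of the sum of F (n m) over m <= M: ln M! contributes
   -M and the harmonic sum -g M. What remains is logarithmic. *)
pose F (j : nat) : R := psi (N %/ j) - N%:R / j%:R + (g + 1).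
have G (n : nat) : (0 < n <= N)%N ->
    `|\sum_(1 <= m < (N %/ n).+1) F (n * m)%N| <= 3 + ln (N%:R / n%:R).
  move=> /andP[n0 nN]; set M := (N %/ n)%N; set y : R := N%:R / n%:R.
  have M0 : (0 < M)%N by rewrite divn_gt0.
  have M0' : (0 : R) < M%:R by rewrite ltr0n.
  have -> : \sum_(1 <= m < M.+1) F (n * m)%N
      = ln M`!%:R - y * harmonic_sum M + (g + 1) * M%:R.
    rewrite /F big_split sumrB /= ln_fact_psi; congr (_ - _ + _).
    - by apply: eq_bigr => m _; rewrite divnMA.
    - by rewrite /harmonic_sum mulr_sumr; apply: eq_bigr => m _;
        rewrite natrM invfM mulrA.
    - by rewrite sumr_const_nat subSS subn0 mulr_natr.
  have [My yM] := @natr_divn_bounds R N n n0; rewrite -/M -/y in My yM.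
  have lMy : ln M%:R <= ln y by rewrite ler_ln ?posrE ?(lt_le_trans M0').
  have [lo hi] := @ln_fact_bounds R M M0.
  have /andP[h1 h2] := hg M M0.
  have lM := @ln_nat_ge0 R M.
  have MV : M%:R * (harmonic_sum M - ln M%:R - g) <= 1.
    by apply: (le_trans (ler_wpM2l (ltW M0') h2)); rewrite divff ?gt_eqF.
  have MV0 : 0 <= M%:R * (harmonic_sum M - ln M%:R - g).
    by rewrite mulr_ge0 // ltW.
  have HM : harmonic_sum M <= ln M%:R + 2 :> R.
    have : (M%:R : R)^-1 <= 1 by rewrite invf_le1 // ler1n.
    by set u := _^-1 in h2 *; lra.
  have HM0 : 0 <= harmonic_sum M :> R by lra.
  have yH0 : 0 <= (y - M%:R) * harmonic_sum M by rewrite mulr_ge0 // subr_ge0.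
  have yH : (y - M%:R) * harmonic_sum M <= harmonic_sum M.
    by rewrite ler_piMl //; lra.
  rewrite ler_norml; apply/andP; split; nra.
have B : `|F 1%N * ln N%:R + \sum_(1 <= j < N.+1) Lambda j * F j| <= 56 * N%:R.
  rewrite -iseki //; apply: le_trans (ler_norm_sum _ _ _) _.
  apply: (@le_trans _ _ (\sum_(1 <= n < N.+1)
     28 * Num.sqrt N%:R * (Num.sqrt n%:R)^-1)).
    rewrite big_nat_cond [leRHS]big_nat_cond; apply: ler_sum => n.
    move=> /andP[/andP[n0 nN] _].
    have n0' : (0 : R) < n%:R by rewrite ltr0n.
    have y1 : (1 : R) <= N%:R / n%:R by rewrite ler_pdivlMr // mul1r ler_nat.
    have l0 := ln_ge0 y1.
    rewrite !normrM (ger0_norm l0) -mulrA -sqrtrV // -sqrtrM //.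
    apply: le_trans (ln_quadratic_bound _ y1).
    have mu1 : `|(moebius n)%:~R : R| <= 1.
      by rewrite -intr_norm (_ : 1 = 1%:~R) // ler_int; exact: moebius_le1.
    apply: le_trans (ler_wpM2l l0 (G n _)); last by rewrite n0.
    by rewrite ler_piMl // mulr_ge0.
  rewrite -mulr_sumr; have := sum_inv_sqrt N; set S := \sum_(_ <= _ < _) _.
  have s0 := sqrtr_ge0 (N%:R : R).
  have s2 : Num.sqrt N%:R ^+ 2 = N%:R :> R by rewrite sqr_sqrtr.
  by rewrite -{3}s2; nra.
(* The two copies of N ln N in the formula come from the term -N of F 1 and, through Mertens, from
   the terms -N / j. *)
have E : \sum_(1 <= j < N.+1) Lambda j * F j =
   \sum_(1 <= j < N.+1) Lambda j * psi (N %/ j)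
   - N%:R * \sum_(1 <= j < N.+1) Lambda j / j%:R + (g + 1) * psi N.
  have -> : psi N = \sum_(1 <= j < N.+1) Lambda j by [].
  rewrite !mulr_sumr -sumrB -big_split /=; apply: eq_bigr => j _.
  by rewrite /F; ring.
move: B; rewrite E /F divn1 divr1.
have /andP[m1 m2] := @mertens R N N0; have p1 := @psi_upper R N; have p0 := @psi_ge0 R N.
have l1 := @ln_le_sub1 R _ N0'; have l0 := @ln_nat_ge0 R N.
move: m1 m2; set S := \sum_(_ <= _ < _) (_ / _); set T := \sum_(_ <= _ < _) _.
move=> m1 m2.
have m1' : N%:R * (ln N%:R - 1) <= N%:R * S by rewrite ler_wpM2l // ltW.
have m2' : N%:R * S <= N%:R * (ln N%:R + 5) by rewrite ler_wpM2l // ltW.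
have c1 : (g + 1) * ln N%:R <= 2 * ln N%:R by rewrite ler_wpM2r //; lra.
have c2 : (g + 1) * psi N <= 2 * psi N by rewrite ler_wpM2r //; lra.
have c3 : 0 <= (g + 1) * ln N%:R by rewrite mulr_ge0 //; lra.
have c4 : 0 <= (g + 1) * psi N by rewrite mulr_ge0 //; lra.
rewrite !ler_norml => /andP[b1 b2]; apply/andP; split; lra.
Qed.

End Selberg.

(** * Selberg's formula at real arguments and for increments of psi *)

Section RealPsi.
Context {R : realType}.
Local Notation Lambda := (@vonMangoldt R).
Local Notation psi := (@psi R).

Lemma truncn_divn (x : R) (j : nat) : 0 <= x -> (0 < j)%N ->
  Num.truncn (x / j%:R) = (Num.truncn x %/ j)%N.
Proof.
move=> x0 j0; have j0' : (0 : R) < j%:R by rewrite ltr0n.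
have /andP[h1 h2] := truncn_itv x0.
apply/eqP; rewrite truncn_eq ?divr_ge0 // ler_pdivlMr // ltr_pdivrMr //.
apply/andP; split.
  by apply: le_trans h1; rewrite -natrM ler_nat leq_divM.
by apply: lt_le_trans h2 _; rewrite -natrM ler_nat ltn_ceil.
Qed.

Lemma sum_truncn (M : nat) (u : R) (P : pred nat) (F : nat -> R) :
  0 <= u -> (Num.truncn u <= M)%N ->
  \sum_(1 <= n < (Num.truncn u).+1 | P n) F n
  = \sum_(1 <= n < M.+1 | (n%:R <= u) && P n) F n.
Proof.
move=> u0 uM; rewrite (@big_nat_widen _ _ _ _ _ M.+1) //.
by apply: eq_bigl => n; rewrite ltnS truncn_ge_nat // andbC.
Qed.

Definition rpsi (x : R) : R := psi (Num.truncn x).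

Lemma rpsi_le (x y : R) : x <= y -> rpsi x <= rpsi y.
Proof. by move=> xy; apply/psi_le/le_truncn. Qed.

Lemma rpsi_ge0 (x : R) : 0 <= rpsi x.
Proof. exact: psi_ge0. Qed.

Lemma rpsi_upper (x : R) : 0 <= x -> rpsi x <= 4 * x.
Proof.
move=> x0; apply: le_trans (psi_upper _) _.
by rewrite ler_wpM2l // truncn_le.
Qed.

Lemma truncn_ln (x : R) : 1 <= x ->
  [/\ (0 < Num.truncn x)%N, ln (Num.truncn x)%:R <= ln x &
      (Num.truncn x)%:R * (ln x - ln (Num.truncn x)%:R) <= 1].
Proof.
move=> x1; have x0 : 0 < x by lra.
have N0 : (0 < Num.truncn x)%N by rewrite truncn_gt0.
have N0' : (0 : R) < (Num.truncn x)%:R by rewrite ltr0n.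
have /andP[h1 h2] := truncn_itv (ltW x0).
split=> //; first by rewrite ler_ln.
rewrite -ln_div ?posrE //.
have h := ln_le_sub1 _ (divr_gt0 x0 N0').
apply: (le_trans (ler_wpM2l (ltW N0') h)).
by rewrite mulrBr mulr1 mulrC divfK ?gt_eqF // lerBlDl natr1 ltW.
Qed.

(** Selberg's formula averages the intervals (x / j, l x / j], relative to their left ends, with
    weights Lambda j / j. This is the total weight, ln x + O(1) by Mertens. *)
Definition mass (x : R) : R :=
  \sum_(1 <= j < (Num.truncn x).+1) Lambda j / j%:R.

Lemma mass_bounds (x : R) : 1 <= x -> ln x - 2 <= mass x /\ mass x <= ln x + 5.
Proof.
move=> x1; have [N0 l1 l2] := truncn_ln x x1.
have /andP[m1 m2] := @mertens R _ N0; rewrite /mass.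
have : ln x - ln (Num.truncn x)%:R <= 1.
  apply: le_trans l2; rewrite ler_peMl ?subr_ge0 //.
  by rewrite ler1n.
by split; lra.
Qed.

Lemma selberg_real (x : R) : 1 <= x ->
  `|rpsi x * ln x + \sum_(1 <= j < (Num.truncn x).+1) Lambda j * rpsi (x / j%:R)
    - 2 * (x * ln x)| <= 90 * x.
Proof.
move=> x1; have x0 : 0 <= x by lra.
have [N0 l1 l2] := truncn_ln x x1.
have := @selberg R _ N0; rewrite -/(rpsi x).
have -> : \sum_(1 <= j < (Num.truncn x).+1) Lambda j * rpsi (x / j%:R)
   = \sum_(1 <= j < (Num.truncn x).+1) Lambda j * psi (Num.truncn x %/ j).
  by apply: eq_big_nat => j /andP[j0 _]; rewrite /rpsi truncn_divn.
have p0 := rpsi_ge0 x.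
have p1 : rpsi x <= 4 * (Num.truncn x)%:R by exact: psi_upper.
set N : R := (Num.truncn x)%:R in l1 l2 p1 *.
have N1 : 1 <= N by rewrite ler1n.
have /andP[Nx xN] : N <= x < N + 1 by rewrite /N natr1 truncn_itv.
have lx := ln_le_sub1 x ltac:(lra).
have e1 : rpsi x * (ln x - ln N) <= 4 * N * (ln x - ln N).
  by rewrite ler_wpM2r // subr_ge0.
have e2 : 0 <= rpsi x * (ln x - ln N) by rewrite mulr_ge0 // subr_ge0.
have e3 : 0 <= N * (ln x - ln N) by rewrite mulr_ge0 ?subr_ge0 //; lra.
have e4 : 0 <= (x - N) * ln x by rewrite mulr_ge0 ?subr_ge0 // ln_ge0.
have e5 : (x - N) * ln x <= 1 * ln x.
  by rewrite ler_wpM2r ?ln_ge0 //; lra.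
set T := \sum_(_ <= _ < _) _.
rewrite !ler_norml => /andP[h1 h2]; apply/andP; split; lra.
Qed.

(** The psi-mass of (x, l x]. The ratio l is the parameter, and not the length, since it is
    preserved when x is divided by j. *)
Definition gap (l x : R) : R := rpsi (l * x) - rpsi x.

Lemma gap_ge0 (l x : R) : 1 <= l -> 0 <= x -> 0 <= gap l x.
Proof. by move=> l1 x0; rewrite subr_ge0 rpsi_le // ler_peMl. Qed.

Lemma gap_le (l m x : R) : l <= m -> 0 <= x -> gap l x <= gap m x.
Proof. by move=> lm x0; rewrite lerD2r rpsi_le // ler_wpM2r. Qed.

Lemma gap_upper (l x : R) : 1 <= l -> 0 <= x -> gap l x <= 4 * l * x.
Proof.
move=> l1 x0; have := @rpsi_upper (l * x) ltac:(nra); have := rpsi_ge0 x.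
by rewrite /gap; lra.
Qed.

(** Selberg's formula at l x minus the one at x. The surplus terms x < j <= l x have l x / j <= B
    and add up to O(B^2 x). The error depends on B alone, because the formula is later applied to a
    ratio known only up to bounds. *)
Lemma selberg_gap (B l x : R) : 1 <= l <= B -> 1 <= x ->
  `|gap l x * ln x
    + \sum_(1 <= j < (Num.truncn x).+1) Lambda j * gap l (x / j%:R)
    - 2 * (l - 1) * (x * ln x)| <= 230 * B ^+ 2 * x.
Proof.
move=> /andP[l1 lB] x1; have x0 : 0 < x by lra.
have lx1 : 1 <= l * x by nra.
have h1 := selberg_real x x1; have := selberg_real _ lx1.
set N := Num.truncn x; set M := Num.truncn (l * x).
have NM : (N <= M)%N by apply: le_truncn; rewrite ler_peMl // ltW.
rewrite (@big_cat_nat _ _ _ N.+1 1 M.+1) //=.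
set T := \sum_(N.+1 <= _ < _) _.
have T0 : 0 <= T.
  by apply: sumr_ge0 => j _; rewrite mulr_ge0 ?vonMangoldt_ge0 ?rpsi_ge0.
have p0 := rpsi_ge0 (l * x).
have p1 : rpsi (l * x) <= 4 * (l * x) by apply: rpsi_upper; lra.
have lx2 : l * x <= B * x by rewrite ler_wpM2r // ltW.
have T1 : T <= 4 * B * (4 * (B * x)).
  apply: (@le_trans _ _ (\sum_(N.+1 <= j < M.+1) Lambda j * (4 * B))).
    rewrite /T big_nat_cond [leRHS]big_nat_cond; apply: ler_sum => j.
    move=> /andP[/andP[Nj _] _]; rewrite ler_wpM2l ?vonMangoldt_ge0 //.
    have xj : x < j%:R.
      by apply: (@lt_le_trans _ _ N.+1%:R); rewrite ?ler_nat // truncnS_gt.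
    have j0 : 0 < j%:R :> R by lra.
    have : l * x / j%:R <= B by rewrite ler_pdivrMr //; nra.
    have := @rpsi_upper (l * x / j%:R) ltac:(by rewrite divr_ge0 //; lra).
    by lra.
  rewrite -mulr_suml mulrC ler_wpM2l //; first by lra.
  apply: (@le_trans _ _ (rpsi (l * x))); last by lra.
  rewrite /rpsi /psi -/M [leRHS](@big_cat_nat _ _ _ N.+1) //= lerDr.
  by rewrite sumr_ge0 // => j _; exact: vonMangoldt_ge0.
have -> : \sum_(1 <= j < N.+1) Lambda j * gap l (x / j%:R) =
    \sum_(1 <= j < N.+1) Lambda j * rpsi (l * x / j%:R) -
    \sum_(1 <= j < N.+1) Lambda j * rpsi (x / j%:R).
  by rewrite -sumrB; apply: eq_bigr => j _; rewrite /gap mulrBr mulrA.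
rewrite /gap; move: h1; rewrite -/N.
set S1 := \sum_(_ <= _ < _) _; set S2 := \sum_(_ <= _ < _) _.
rewrite lnM ?posrE //; last by lra.
have ll0 : 0 <= ln l by rewrite ln_ge0.
have ll1 : ln l <= B by have := ln_le_sub1 l ltac:(lra); lra.
have e1 : 0 <= rpsi (l * x) * ln l by rewrite mulr_ge0.
have e2 : rpsi (l * x) * ln l <= 4 * (B * x) * B.
  by rewrite ler_pM //; lra.
have e3 : 0 <= l * x * ln l by rewrite mulr_ge0 //; lra.
have e4 : l * x * ln l <= B * x * B by rewrite ler_pM //; lra.
have e5 : B * x <= B ^+ 2 * x by rewrite ler_wpM2r ?(ltW x0) //; nra.
have e6 : x <= B * x by rewrite ler_peMl ?(ltW x0) //; lra.
rewrite !ler_norml => /andP[a1 a2] /andP[b1 b2]; apply/andP; split; lra.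
Qed.

End RealPsi.

(** * Prime powers in short intervals *)

Section PrimePowerGaps.
Context {R : realType}.
Local Notation Lambda := (@vonMangoldt R).

Lemma ln_unbounded (c : R) : exists2 Y : R, 1 <= Y & forall x, Y <= x -> c <= ln x.
Proof.
exists (Num.max 1 (expR c)); first by rewrite le_max lexx.
move=> x; rewrite ge_max => /andP[x1 cx].
by rewrite -[c]expRK ler_ln ?posrE ?expR_gt0 //; lra.
Qed.

Lemma mass_le (x y : R) : x <= y -> mass x <= mass y.
Proof.
move=> /le_truncn xy; rewrite /mass [leRHS](@big_cat_nat _ _ _ (Num.truncn x).+1) //=.
by rewrite lerDl sumr_ge0 // => j _; rewrite divr_ge0 ?vonMangoldt_ge0.
Qed.

(** The sum in Selberg's formula is nonnegative; dropping it and dividing by ln x gives the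
    bound. *)
Lemma gap_density_le2 (B eta : R) : 1 <= B -> 0 < eta ->
  exists2 X : R, 1 <= X & forall l x, 1 <= l <= B -> X <= x ->
    gap l x <= (2 * (l - 1) + eta) * x.
Proof.
move=> B1 e0; set K := 230 * B ^+ 2.
have [X X1 hX] := ln_unbounded (Num.max 1 (K / eta)).
exists X => // l x lB Xx; have x1 : 1 <= x by lra.
have := hX x Xx; rewrite ge_max ler_pdivrMr // => /andP[l1 lK].
have := selberg_gap B l x lB x1; rewrite -/K ler_norml => /andP[_].
have : 0 <= \sum_(1 <= j < (Num.truncn x).+1) Lambda j * gap l (x / j%:R).
  apply: sumr_ge0 => j _; rewrite mulr_ge0 ?vonMangoldt_ge0 ?gap_ge0 ?divr_ge0 //.
  - by case/andP: lB.
  - by lra.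
set S := \sum_(_ <= _ < _) _ => S0 h.
have Kx : K * x <= ln x * eta * x by rewrite ler_wpM2r //; lra.
by rewrite -(@ler_pM2r _ (ln x)); lra.
Qed.

(* One direction of the duality between empty and full intervals: by Selberg's
   formula, a full interval at [y] forces nearly empty ones at some [y / m]. *)
Lemma dense_to_gap (B eta X : R) : 1 <= B -> 0 < eta -> 1 <= X ->
  exists2 Y : R, 1 <= Y & forall l y, 1 <= l <= B -> Y <= y ->
    (2 * (l - 1) - eta / 2) * y <= gap l y ->
    exists2 z, X <= z & gap l z <= eta * z.
Proof.
move=> B1 e0 X1; set K := 230 * B ^+ 2.
(* If every z >= X had gap l z > eta z, the sum would be at least eta y (ln y - ln X - 2), while
   density at y leaves it at most (eta / 2) y ln y + K y. The threshold makes these incompatible. *)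
have [Y Y1 hY] := ln_unbounded ((K + eta * (ln X + 2)) * 2 / eta + 1).
exists (Num.max X Y); first by rewrite le_max X1.
move=> l y lB; rewrite ge_max => /andP[Xy Yy] dense.
have /andP[l1 _] := lB; have y1 : 1 <= y by lra.
apply: contrapT => no.
have big z : X <= z -> eta * z <= gap l z.
  by move=> Xz; case: (lerP (gap l z) (eta * z)) => [h|/ltW//]; case: no; exists z.
have yX1 : 1 <= y / X by rewrite ler_pdivlMr ?mul1r //; lra.
have NM : (Num.truncn (y / X) <= Num.truncn y)%N.
  by apply: le_truncn; rewrite ler_pdivrMr; [nra|lra].
have := selberg_gap B l y lB y1; rewrite -/K ler_norml => /andP[_].
rewrite (@big_cat_nat _ _ _ (Num.truncn (y / X)).+1 1 (Num.truncn y).+1) //=.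
set S := (X in _ + (X + _) - _); set T := (X in _ + (_ + X) - _).
have T0 : 0 <= T.
  apply: sumr_ge0 => j _; rewrite mulr_ge0 ?vonMangoldt_ge0 ?gap_ge0 ?divr_ge0 //.
  by lra.
have S0 : eta * y * mass (y / X) <= S.
  rewrite /mass /S mulr_sumr [leLHS]big_nat_cond [leRHS]big_nat_cond; apply: ler_sum => j.
  move=> /andP[/andP[j0 jN] _]; have j0' : (0 : R) < j%:R by rewrite ltr0n.
  rewrite mulrCA ler_wpM2l ?vonMangoldt_ge0 // -mulrA big //.
  move: jN; rewrite ltnS truncn_ge_nat; last by lra.
  by rewrite !ler_pdivlMr 1?mulrC //; lra.
have [m1 _] := mass_bounds _ yX1.
have m2 : eta * y * (ln (y / X) - 2) <= eta * y * mass (y / X).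
  by rewrite ler_wpM2l // mulr_ge0 //; lra.
have := hY y Yy; rewrite -lerBrDr ler_pdivrMr // => hy.
move: m2; rewrite ln_div ?posrE; [|lra..] => m2 h.
have ly0 : 0 <= ln y by rewrite ln_ge0.
have d : (2 * (l - 1) - eta / 2) * y * ln y <= gap l y * ln y by rewrite ler_wpM2r.
have c : (K + eta * (ln X + 2)) * 2 * y <= (ln y - 1) * eta * y.
  by rewrite ler_wpM2r //; lra.
have ey : 0 < eta * y by rewrite mulr_gt0 //; lra.
by lra.
Qed.

(* The other direction: an empty interval at [x] forces full ones at [x / j]
   for all [j] up to a set of small mass for the weights [Lambda j / j]. *)
Lemma gap_to_dense (l eta1 eta2 X : R) : 1 <= l -> 0 < eta1 -> 0 < eta2 ->
  1 <= X -> exists X1 Y eta : R, [/\ X <= X1, 1 <= Y, 0 < eta & forall x, Y <= x ->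
    gap l x <= eta * x ->
    \sum_(1 <= j < (Num.truncn (x / X1)).+1
       | gap l (x / j%:R) < (2 * (l - 1) - eta1) * (x / j%:R)) Lambda j / j%:R
    <= eta2 * ln x].
Proof.
move=> l1 e1 e2 X1; set K := 230 * l ^+ 2.
(* Selberg's formula bounds eta1 M by 2 eta ln x + c: one eta from the hypothesis on [gap l x], one
   from the density bound at the points x / j. The choice of Y bounds c by eta ln x. *)
pose eta := eta1 * eta2 / 4; have e0 : 0 < eta by rewrite divr_gt0 ?mulr_gt0.
have [X2 X21 hX2] := gap_density_le2 l eta l1 e0.
pose Z := Num.max X X2; have Z1 : 1 <= Z by rewrite le_max X1.
pose c := K + 4 * l * (ln Z + 7) + (2 * (l - 1) + eta) * 5.
have [Y Y1 hY] := ln_unbounded (c / eta).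
exists Z, (Num.max Z Y), eta; split=> //; first by rewrite le_max lexx.
  by rewrite le_max Z1.
move=> x; rewrite ge_max => /andP[Zx Yx] hgap; have x1 : 1 <= x by apply: le_trans Zx.
have x0 : 0 < x by apply: lt_le_trans x1.
have l0 : 0 < l by apply: lt_le_trans l1.
have a0 : 0 <= 2 * (l - 1) + eta by rewrite addr_ge0 ?mulr_ge0 ?subr_ge0 // ltW.
set bad := fun j : nat => gap l (x / j%:R) < (2 * (l - 1) - eta1) * (x / j%:R).
set M := \sum_(_ <= _ < _ | _) _.
have xZ1 : 1 <= x / Z by rewrite ler_pdivlMr ?mul1r //; lra.
have xZx : x / Z <= x by rewrite ler_pdivrMr; [nra|lra].
have NM := le_truncn xZx.
have := selberg_gap l l x ltac:(by rewrite l1 lexx) x1.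
rewrite -/K ler_norml => /andP[+ _].
rewrite (@big_cat_nat _ _ _ (Num.truncn (x / Z)).+1 1 (Num.truncn x).+1) //=.
set S := (X in _ + (X + _) - _); set T := (X in _ + (_ + X) - _) => h.
have T0 : T <= 4 * l * x * (mass x - mass (x / Z)).
  rewrite /mass (@big_cat_nat _ _ _ (Num.truncn (x / Z)).+1 1 (Num.truncn x).+1) //=.
  rewrite addrAC subrr add0r mulr_sumr /T; apply: ler_sum => j _.
  rewrite [leRHS]mulrCA ler_wpM2l ?vonMangoldt_ge0 // -(mulrA (4 * l)).
  by rewrite gap_upper // divr_ge0 //; lra.
have S0 : S <= (2 * (l - 1) + eta) * x * mass (x / Z) - eta1 * x * M.
  rewrite /M [X in _ - _ * X]big_mkcond /mass /S !mulr_sumr -sumrB [leLHS]big_nat_cond [leRHS]big_nat_cond.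
  apply: ler_sum => j /andP[/andP[j0 jN] _].
  have j0' : (0 : R) < j%:R by rewrite ltr0n.
  have xj : 0 <= x / j%:R by rewrite divr_ge0 //; lra.
  have L0 := @vonMangoldt_ge0 R j.
  have E (a : R) : a * x * (Lambda j / j%:R) = Lambda j * (a * (x / j%:R)) by ring.
  case: ifP => [bj|_]; rewrite ?mulr0 ?subr0 !E -?mulrBr ler_wpM2l //.
    rewrite -mulrBl; apply: (le_trans (ltW bj)); rewrite ler_wpM2r //; lra.
  apply: hX2; first by rewrite l1 lexx.
  move: jN; rewrite ltnS truncn_ge_nat; last by lra.
  rewrite !ler_pdivlMr ?(lt_le_trans ltr01 Z1) // => jZ.
  have : X2 <= Z by rewrite le_max lexx orbT.
  by nra.
have [m1 m2] := mass_bounds _ xZ1; have [m3 m4] := mass_bounds _ x1.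
have lx0 : 0 <= ln x by rewrite ln_ge0.
have t1 : 4 * l * x * (mass x - mass (x / Z)) <= 4 * l * x * (ln Z + 7).
  rewrite ler_wpM2l ?mulr_ge0 ?(ltW l0) ?(ltW x0) //.
  move: m1 m4; rewrite ln_div ?posrE ?(lt_le_trans ltr01 Z1) //; clear; lra.
have t2 : (2 * (l - 1) + eta) * x * mass (x / Z)
    <= (2 * (l - 1) + eta) * x * (ln x + 5).
  rewrite ler_wpM2l ?mulr_ge0 ?(ltW x0) //.
  by apply: le_trans m4; exact: mass_le.
have g : gap l x * ln x <= eta * x * ln x by rewrite ler_wpM2r.
have := hY x Yx; rewrite ler_pdivrMr // => hy.
have hc : c * x <= ln x * eta * x by rewrite ler_wpM2r ?(ltW x0).
have e1x : 0 < eta1 * x by rewrite mulr_gt0.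
rewrite -(ler_pM2l e1x).
have -> : eta1 * x * (eta2 * ln x) = 4 * eta * x * ln x by rewrite /eta; field.
have exl : 0 <= eta * x * ln x by exact: mulr_ge0 (mulr_ge0 (ltW e0) (ltW x0)) lx0.
rewrite /c in hc; clear hY hX2 hy hgap m1 m2 m3 m4 NM; lra.
Qed.

End PrimePowerGaps.

(** * Enlarging the ratio of sparse intervals *)

Section GapGrowth.
Context {R : realType}.
Local Notation Lambda := (@vonMangoldt R).

Let weight (n : nat) : R := Lambda n / n%:R.

Let weight_ge0 (n : nat) : 0 <= weight n.
Proof. by rewrite divr_ge0 ?vonMangoldt_ge0. Qed.

Lemma cluster_mass (rho X eta g : R) (M : nat) : 1 < rho -> 0 < X ->
  (forall x, X <= x -> gap (rho ^+ 2) x <= eta * x) ->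
  rho * X <= g ->
  \sum_(1 <= n < M.+1 | g <= n%:R <= rho * g) weight n <= eta.
Proof.
move=> r1 X0 hX gX; have r0 : 0 < rho by lra.
have g0 : 0 < g by apply: lt_le_trans gX; rewrite mulr_gt0.
have e0 : 0 <= eta.
  have := hX X (lexx _); have : 0 <= gap (rho ^+ 2) X.
    by rewrite gap_ge0 ?ltW // exprn_egt1.
  by move=> h1 h2; rewrite -(pmulr_lge0 _ X0) (le_trans h1).
(* The half-open interval (z, rho^2 z] has to contain the closed [g, rho g], so it starts strictly
   below g; hence the ratio rho^2. *)
set z := g / rho; have z0 : 0 < z by rewrite divr_gt0.
have zX : X <= z by rewrite /z ler_pdivlMr // mulrC.
have zg : z < g by rewrite /z ltr_pdivrMr //; nra.
have rz : rho ^+ 2 * z = rho * g by rewrite /z; field; rewrite gt_eqF.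
have := hX z zX; rewrite /gap rz.
set N := (M + Num.truncn (rho * g))%N.
have rg0 : 0 <= rho * g by rewrite mulr_ge0 ?ltW.
have zrg : z <= rho * g by nra.
have -> : rpsi (rho * g) = \sum_(1 <= n < N.+1 | (n%:R <= rho * g) && true) Lambda n.
  by rewrite /rpsi /psi (sum_truncn N) // leq_addl.
have -> : rpsi z = \sum_(1 <= n < N.+1 | (n%:R <= z) && true) Lambda n.
  rewrite /rpsi /psi (sum_truncn N) ?(ltW z0) //.
  by rewrite (leq_trans (le_truncn zrg)) // leq_addl.
set A := \sum_(_ <= _ < _ | _) _; set B := \sum_(_ <= _ < _ | _) _ => AB.
set C := \sum_(_ <= _ < _ | _) _.
have CN : C <= \sum_(1 <= n < N.+1 | g <= n%:R <= rho * g) weight n.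
  rewrite [leRHS](@big_cat_nat _ _ _ M.+1) //=; last by rewrite ltnS leq_addr.
  by rewrite lerDl sumr_ge0.
have gC : g * C <= A - B.
  apply: (le_trans (ler_wpM2l (ltW g0) CN)).
  rewrite lerBrDr mulr_sumr /A /B [X in X + _]big_mkcond [X in _ + X]big_mkcond.
  rewrite -big_split [leRHS]big_mkcond [leLHS]big_nat_cond [leRHS]big_nat_cond /=.
  apply: ler_sum => n /andP[/andP[n0 _] _]; rewrite !andbT.
  have n0' : (0 : R) < n%:R by rewrite ltr0n.
  have L0 := @vonMangoldt_ge0 R n.
  case: (lerP g n%:R) => gn /=; last first.
    rewrite add0r; case: (lerP n%:R z) => nz; last by case: ifP.
    by rewrite (le_trans nz).
  rewrite [X in if X then Lambda n else 0](_ : _ = false) ?addr0; last first.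
    by apply/negbTE; rewrite -ltNge; lra.
  case: ifP => // _; rewrite /weight mulrCA ler_piMr //.
  by rewrite ler_pdivrMr // mul1r.
rewrite -(ler_pM2l g0); apply: (le_trans gC); apply: (le_trans AB).
by rewrite mulrC ler_wpM2r // ltW.
Qed.

(** Otherwise the good integers of each window (u, l u] lie within a factor rho of the least one,
    and so weigh at most ln l / 2, half of the typical mass ln l. Together with the bad ones they
    would make up only about 3/4 of the mass ln x given by Mertens. *)
Lemma close_good_pair (l rho X : R) : 1 < l -> 1 < rho ->
  2 * (rho ^+ 2 - 1) <= ln l / 4 -> 1 <= X ->
  exists2 Y : R, 1 <= Y & forall (x : R) (bad : pred nat), Y <= x ->
    \sum_(1 <= j < (Num.truncn (x / X)).+1 | bad j) Lambda j / j%:R <= 1 / 4 * ln x ->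
    exists n1 n2 : nat, [/\ (0 < n1)%N, ~~ bad n1 /\ ~~ bad n2, n2%:R <= x / X,
      rho * n1%:R <= n2%:R & n2%:R <= l * n1%:R].
Proof.
move=> l1 r1 rl X1; have ll0 : 0 < ln l by rewrite ln_gt0.
have r21 : 1 <= rho ^+ 2 by rewrite exprn_ege1 // ltW.
have l40 : 0 < ln l / 4 by rewrite divr_gt0.
have [X0 X01 hX0] := gap_density_le2 (rho ^+ 2) (ln l / 4) r21 l40.
pose u0 := rho * X0; have u01 : 1 <= u0 by rewrite /u0; nra.
(* Without a pair, ln (x / X) - 2 <= ln u0 + 5 + ln x / 4 + (ln (x / X) + ln l) / 2, which fails
   beyond this threshold. *)
have [Y Y1 hY] := ln_unbounded (4 * (ln X / 2 + 8 + ln u0 + ln l / 2)).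
exists (Num.max (X * u0) Y); first by rewrite le_max Y1 orbT.
move=> x bad; rewrite ge_max => /andP[xXu Yx].
have X0' : 0 < X by lra.
have ux : u0 <= x / X by rewrite ler_pdivlMr // mulrC.
have x1 : 1 <= x by lra.
set M := Num.truncn (x / X); set bm := \sum_(_ <= _ < _ | _) _ => hbad.
apply: contrapT => no.
have cl (g : R) : u0 <= g ->
    \sum_(1 <= n < M.+1 | g <= n%:R <= rho * g) weight n <= ln l / 2.
  apply: (cluster_mass rho X0) => //; first by lra.
  move=> z zX; apply: (le_trans (hX0 (rho ^+ 2) z _ zX)); first by rewrite r21 lexx.
  by rewrite ler_wpM2r //; lra.
pose W (u v : R) := \sum_(1 <= n < M.+1 | (u < n%:R <= v) && ~~ bad n) weight n.
have W1 (u : R) : u0 <= u -> W u (l * u) <= ln l / 2.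
  move=> uu; pose Q (n : nat) := [&& (0 < n <= M)%N, u < n%:R <= l * u & ~~ bad n].
  case: (pselect (exists n, Q n)) => [exQ|noQ]; last first.
    rewrite /W big_nat_cond big1; first by lra.
    move=> n /andP[/andP[n0 nM] /andP[h1 h2]]; case: noQ; exists n.
    by rewrite /Q n0 h1 h2 -ltnS nM.
  (* The least good element g of the window: a good n in the window with n > rho g would form a pair
     with g, as n <= l u < l g. *)
  case: (ex_minnP exQ) => g /and3P[/andP[g0 gM] /andP[ug glu] gb] gmin.
  apply: le_trans (cl g%:R _); last by lra.
  rewrite /W [leLHS]big_nat_cond [leRHS]big_nat_cond big_mkcond [leRHS]big_mkcond.
  apply: ler_sum => n _; case: ifP => [|_]; last by case: ifP.
  move=> /andP[/andP[n0 nM] /andP[/andP[un nlu] nb]].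
  have gn : (g <= n)%N by apply: gmin; rewrite /Q n0 un nlu nb -ltnS nM.
  rewrite n0 nM ler_nat gn /=; case: ifP => // /negbT; rewrite -ltNge => rgn.
  case: no; exists g, n; split=> //; last by nra.
    by move: nM; rewrite ltnS truncn_ge_nat //; lra.
  exact: ltW.
have WT (T : nat) : W u0 (u0 * l ^+ T) <= T%:R * (ln l / 2).
  elim: T => [|T IH].
    rewrite mul0r expr0 mulr1 /W big1 // => n /andP[/andP[h1 h2] _].
    by have := lt_le_trans h1 h2; rewrite ltxx.
  have lT : 1 <= l ^+ T by rewrite exprn_ege1 // ltW.
  have uT : u0 <= u0 * l ^+ T by nra.
  have h := W1 _ uT.
  rewrite -[T.+1%:R]natr1 mulrDl mul1r exprS (mulrCA u0).
  apply: le_trans (lerD IH h); rewrite /W.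
  rewrite big_mkcond [X in _ <= X + _]big_mkcond [X in _ <= _ + X]big_mkcond -big_split /=.
  apply: ler_sum => n _; case: (bad n); rewrite ?andbF ?addr0 // !andbT.
  case: (ltP u0 n%:R) => /= h1.
    by case: (lerP n%:R (u0 * l ^+ T)) => h2 /=; case: ifP; rewrite ?add0r ?addr0.
  by rewrite add0r; case: ifP.
have y1 : 1 <= x / X by lra.
have [T Tl lT] : exists2 T, T%:R * ln l <= ln (x / X) + ln l & x / X <= l ^+ T.
  exists (Num.truncn (ln (x / X) / ln l)).+1.
    rewrite -[_.+1%:R]natr1 mulrDl mul1r lerD2r -ler_pdivlMr // truncn_le.
    by rewrite divr_ge0 ?ln_ge0 // ltW.
  rewrite -ler_ln ?posrE ?exprn_gt0 ?(lt_le_trans ltr01) //; last exact: ltW.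
  rewrite lnXn ?(lt_le_trans ltr01 (ltW l1)) //.
  by rewrite -[leRHS]mulr_natl -ler_pdivrMr // ltW // truncnS_gt.
have total : mass (x / X) <= mass u0 + bm + W u0 (u0 * l ^+ T).
  have -> : mass u0 = \sum_(1 <= n < M.+1 | (n%:R <= u0) && true) weight n.
    by rewrite /mass (sum_truncn M) //; [lra|exact: le_truncn].
  rewrite /mass -/M /bm /W [X in _ <= X + _ + _]big_mkcond.
  rewrite [X in _ <= _ + X + _]big_mkcond [X in _ <= _ + X]big_mkcond -!big_split /=.
  rewrite [leLHS]big_nat_cond [leRHS]big_nat_cond; apply: ler_sum => n.
  move=> /andP[/andP[n0 nM] _]; rewrite andbT -/(weight n).
  have w0 := weight_ge0 n.
  case: (lerP n%:R u0) => h1 /=.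
    by rewrite -addrA lerDl addr_ge0 //; case: ifP.
  case: (bad n); rewrite ?andbF ?addr0 ?add0r //= andbT ifT //.
  have nx : n%:R <= x / X by move: nM; rewrite ltnS truncn_ge_nat //; lra.
  by rewrite (le_trans nx) // (le_trans lT) // ler_peMl // exprn_ge0 //; lra.
have [m1 _] := mass_bounds _ y1; have [_ m2] := mass_bounds _ u01.
have lxX : ln (x / X) = ln x - ln X.
  by rewrite ln_div ?posrE // (lt_le_trans ltr01).
have := hY x Yx; have := WT T.
move: m1 Tl; rewrite lxX => m1 Tl h1 h2.
have lX : 0 <= ln X by rewrite ln_ge0.
by lra.
Qed.

(* The interval (x / b, l x / a] is the union of (x / b, l x / b] and
   (x / a, l x / a], which overlap in (x / a, l x / b]. *)
Lemma gap_union_dense (l e x a b : R) : 1 < l -> 0 < e -> 0 < x -> 0 < a ->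
  a <= b -> b <= l * a ->
  (forall m, 1 <= m <= l ^+ 2 -> gap m (x / a) <= (2 * (m - 1) + e) * (x / a)) ->
  (2 * (l - 1) - e) * (x / a) <= gap l (x / a) ->
  (2 * (l - 1) - e) * (x / b) <= gap l (x / b) ->
  (2 * (l * b / a - 1) - 3 * l * e) * (x / b) <= gap (l * b / a) (x / b).
Proof.
move=> l1 e0 x0 a0 ab bla hup ga gb; have b0 : 0 < b by apply: lt_le_trans ab.
have l0 : 0 < l by apply: lt_trans l1.
set y := x / b in gb *; set w := x / a in hup ga *; set l' := l * b / a.
have w0 : 0 < w by rewrite divr_gt0.
have y0 : 0 < y by rewrite divr_gt0.
have yw : y <= w by rewrite /y /w ler_pM2l // lef_pV2 ?posrE.
have wly : w <= l * y.
  rewrite /w /y mulrA ler_pdivlMr // mulrAC ler_pdivrMr //.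
  by rewrite (mulrC l) -mulrA ler_pM2l.
have l'y : l' * y = l * w.
  by rewrite /l' /y /w; field; rewrite !gt_eqF.
(* The ratio of the overlap. Its mass is subtracted, so there the upper bound of density 2 is used;
   the three errors sum to e (y + 2 w) <= 3 l e y. *)
pose l2 := l * y / w; have l2w : l2 * w = l * y by rewrite /l2 divfK // gt_eqF.
have l21 : 1 <= l2 by rewrite /l2 ler_pdivlMr // mul1r.
have l2l : l2 <= l ^+ 2.
  rewrite /l2 ler_pdivrMr // expr2 -mulrA ler_pM2l // (le_trans yw) //.
  by rewrite ler_peMl // ltW.
have h2 : gap l2 w <= (2 * (l2 - 1) + e) * w by apply: hup; rewrite l21.
have -> : gap l' y = gap l y + gap l w - gap l2 w.
  by rewrite /gap l'y l2w; ring.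
have ew : e * w <= e * (l * y) by rewrite ler_pM2l.
have ey : e * y <= e * (l * y) by rewrite ler_pM2l // ler_peMl // ltW.
clearbody l2 l' y w; clear hup; lra.
Qed.

(** For l >= 1 this says that the lower limit of gap l x / x at infinity is 0. *)
Definition sparse_intervals (l : R) := forall eta X : R, 0 < eta ->
  exists2 x, X <= x & gap l x <= eta * x.

(** The union has ratio l n2 / n1, known only to lie between l rho and l^2. This is why the
    estimates are uniform over ratios up to l^2; monotonicity of [gap] in the ratio then returns to
    l rho. *)
Lemma sparse_intervals_step (l rho : R) : 1 < l -> 1 < rho -> rho <= l ->
  2 * (rho ^+ 2 - 1) <= ln l / 4 ->
  sparse_intervals l -> sparse_intervals (l * rho).
Proof.
move=> l1 r1 rl hrho Pl eta X0 e0.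
pose X := Num.max 1 X0; have X1 : 1 <= X by rewrite le_max lexx.
suff [z Xz hz] : exists2 z, X <= z & gap (l * rho) z <= eta * z.
  by exists z => //; rewrite (le_trans _ Xz) // le_max lexx orbT.
have B1 : 1 <= l ^+ 2 by rewrite exprn_ege1 // ltW.
have [Y1 Y11 hY1] := dense_to_gap (l ^+ 2) eta X B1 e0 X1.
(* The union loses 3 l eta1 in density, which is exactly the eta / 2 that [dense_to_gap]
   tolerates. *)
pose eta1 := eta / (6 * l).
have e1 : 0 < eta1 by rewrite divr_gt0 //; lra.
have [Y2 Y21 hY2] := gap_density_le2 (l ^+ 2) eta1 B1 e1.
have Y31 : 1 <= Num.max Y1 Y2 by rewrite le_max Y11.
have [X1' [Y4 [eta' [h1 Y41 e0' hY4]]]] :=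
  gap_to_dense l eta1 (1 / 4) (Num.max Y1 Y2) (ltW l1) e1 ltac:(lra) Y31.
move: h1; rewrite ge_max => /andP[Y1X Y2X].
have X1'1 : 1 <= X1' by lra.
have [Y5 Y51 hY5] := close_good_pair l rho X1' l1 r1 hrho X1'1.
have [x + hgap] := Pl eta' (Num.max Y4 Y5) e0'; rewrite ge_max => /andP[Y4x Y5x].
have [n1 [n2 [n10 [g1 g2] n2x rn nl]]] := hY5 x _ Y5x (hY4 x Y4x hgap).
move: g1 g2; rewrite -!leNgt => g1 g2.
have x0 : 0 < x by rewrite (lt_le_trans ltr01) // (le_trans Y41).
have X1'0 : 0 < X1' by rewrite (lt_le_trans ltr01).
have a0 : (0 : R) < n1%:R by rewrite ltr0n.
clear hY4 hY5 hgap Pl Y41 Y51 Y4x Y5x X1'1 n10.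
move: a0 n2x rn nl g1 g2; set a : R := n1%:R; set b : R := n2%:R.
move=> a0 n2x rn nl g1 g2.
have ab : a <= b by rewrite (le_trans _ rn) // ler_peMl // ltW.
have b0 : 0 < b by rewrite (lt_le_trans a0).
have l0 : 0 < l by rewrite (lt_trans ltr01).
have yX : X1' <= x / b by move: n2x; rewrite !ler_pdivlMr // mulrC.
have yw : x / b <= x / a by rewrite ler_pM2l // lef_pV2 ?posrE.
pose l' := l * b / a.
have lrl' : l * rho <= l' by rewrite /l' -mulrA ler_pM2l // ler_pdivlMr.
have l'l : l' <= l ^+ 2.
  by rewrite /l' ler_pdivrMr // expr2 -mulrA ler_pM2l.
have l'1 : 1 <= l' by rewrite (le_trans _ lrl') // (le_trans (ltW r1)) // ler_peMl ?ltW // (lt_trans ltr01).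
have E : 3 * l * eta1 = eta / 2 by rewrite /eta1; field; rewrite gt_eqF.
have := gap_union_dense l eta1 x a b l1 e1 x0 a0 ab nl _ g1 g2.
rewrite E -/l' => h3.
have {}h3 := h3 (fun m hm => hY2 m (x / a) hm (le_trans Y2X (le_trans yX yw))).
have l'B : 1 <= l' <= l ^+ 2 by rewrite l'1.
have [z Xz hz] := hY1 l' (x / b) l'B (le_trans Y1X yX) h3.
exists z => //; apply: le_trans hz; apply: gap_le => //.
by rewrite (le_trans _ Xz) // (le_trans _ X1).
Qed.

(** By Mertens, (x, e^9 x] has mass at least 9 - 2 - 5 = 2 for the weights Lambda j / j, hence
    psi-mass at least 2 x. *)
Lemma no_sparse_intervals_exp9 : ~ sparse_intervals (expR 9).
Proof.
move=> /(_ 1 1 ltr01)[x x1]; apply/negP; rewrite -ltNge mul1r.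
have x0 : 0 < x by lra.
have B1 : 1 <= expR 9 :> R by rewrite -expR0 ler_expR.
have Bx1 : 1 <= expR 9 * x by nra.
have [_ m1] := mass_bounds _ x1; have [m2 _] := mass_bounds _ Bx1.
move: m2; rewrite lnM ?posrE ?expR_gt0 // expRK => m2.
have xB : (Num.truncn x <= Num.truncn (expR 9 * x))%N.
  by apply: le_truncn; rewrite ler_peMl // ltW.
have : x * (mass (expR 9 * x) - mass x) <= gap (expR 9) x.
  rewrite /mass /gap /rpsi /psi.
  rewrite (@big_cat_nat _ _ _ (Num.truncn x).+1 1 (Num.truncn (expR 9 * x)).+1) //=.
  rewrite [leRHS](_ : _ =
    \sum_((Num.truncn x).+1 <= j < (Num.truncn (expR 9 * x)).+1) Lambda j); last first.
    rewrite (@big_cat_nat _ _ _ (Num.truncn x).+1 1 (Num.truncn (expR 9 * x)).+1) //=.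
    by rewrite addrAC subrr add0r.
  rewrite addrAC subrr add0r mulr_sumr [leLHS]big_nat_cond [leRHS]big_nat_cond.
  apply: ler_sum => j /andP[/andP[xj _] _]; have L0 := @vonMangoldt_ge0 R j.
  have xj' : x < j%:R.
    by apply: (@lt_le_trans _ _ (Num.truncn x).+1%:R); rewrite ?ler_nat // truncnS_gt.
  by rewrite mulrCA ler_piMr // ler_pdivrMr ?mul1r ?ltW //; lra.
by nra.
Qed.

Lemma not_sparse_intervals (l : R) : 1 < l -> ~ sparse_intervals l.
Proof.
move=> l1 Pl; have ll0 : 0 < ln l by rewrite ln_gt0.
(* With rho = 1 + d and d <= 1, 2 (rho^2 - 1) <= 6 d <= ln l / 4. The condition on rho only gets
   weaker as the ratio grows, so one d serves all steps and the ratio grows geometrically. *)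
pose d := Num.min 1 (ln l / 24).
have d0 : 0 < d by rewrite lt_min ltr01 divr_gt0.
have d1 : d <= 1 by rewrite ge_min lexx.
have d2 : d <= ln l / 24 by rewrite ge_min lexx orbT.
have ll := ln_le_sub1 l ltac:(lra).
have P i : l <= l * (1 + d) ^+ i /\ sparse_intervals (l * (1 + d) ^+ i).
  elim: i => [|i [IH1 IH2]]; first by rewrite expr0 mulr1 lexx.
  rewrite exprSr mulrA; split; first by nra.
  apply: sparse_intervals_step => //; [lra..|].
  have : ln l <= ln (l * (1 + d) ^+ i) by rewrite ler_ln ?posrE //; lra.
  by nra.
have bern i : 1 + i%:R * d <= (1 + d) ^+ i.
  elim: i => [|i IH]; first by rewrite expr0 mul0r addr0.
  rewrite exprS -natr1; have : 0 <= i%:R * d by rewrite mulr_ge0 // ltW.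
  by nra.
have [i big] : exists i, expR 9 <= l * (1 + d) ^+ i.
  exists (Num.truncn (expR 9 / d)).+1; move: (Num.truncn _).+1 (truncnS_gt (expR 9 / d)).
  move=> i; rewrite ltr_pdivrMr // => h; have b := bern i.
  have p0 : 0 <= (1 + d) ^+ i by rewrite exprn_ge0 //; lra.
  by have : (1 + d) ^+ i <= l * (1 + d) ^+ i; [rewrite ler_peMl // ltW|lra].
apply: no_sparse_intervals_exp9 => eta X e0.
have [x + hx] := (P i).2 eta (Num.max 0 X) e0; rewrite ge_max => /andP[x0 Xx].
by exists x => //; apply: le_trans hx; exact: gap_le.
Qed.

Lemma prime_power_in_interval (l : R) : 1 < l ->
  exists2 X : R, 1 <= X & forall x, X <= x ->
    exists p i : nat, [/\ prime p, (0 < i)%N & x < (p ^ i)%:R <= l * x].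
Proof.
move=> l1; apply: contrapT => H; apply: (not_sparse_intervals l l1) => eta X e0.
apply: contrapT => H2; apply: H; exists (Num.max 1 X); first by rewrite le_max lexx.
move=> x; rewrite ge_max => /andP[x1 Xx]; apply: contrapT => H3; apply: H2.
exists x => //; suff -> : gap l x = 0 by rewrite mulr_ge0 //; lra.
have xl : x <= l * x by nra.
rewrite /gap /rpsi /psi.
rewrite (@big_cat_nat _ _ _ (Num.truncn x).+1 1 (Num.truncn (l * x)).+1) //=; last first.
  by rewrite ltnS le_truncn.
rewrite addrAC subrr add0r big_nat_cond big1 // => n /andP[/andP[xn nl] _].
apply/eqP/negP => /negP/vonMangoldt_prime_power[p [i [pp i0 E]]].
apply: H3; exists p, i; split=> //; rewrite -E; apply/andP; split.
  by apply: (@lt_le_trans _ _ (Num.truncn x).+1%:R); rewrite ?ler_nat // truncnS_gt.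
by move: nl; rewrite ltnS truncn_ge_nat //; nra.
Qed.

End GapGrowth.

(** * Frankl-Wilson *)

Section FranklWilson.

Lemma prime_dvd_of_mul (p e a b c : nat) : prime p ->
  (a * b = p ^ e * c)%N -> (0 < a < p ^ e)%N -> (p %| b)%N.
Proof.
move=> pp E /andP[a0 ap]; apply: contraT => pb.
have cp : coprime (p ^ e) b by rewrite coprimeXl // prime_coprime.
have : (p ^ e %| a * b)%N by rewrite E dvdn_mulr.
by rewrite Gauss_dvdl // => /(dvdn_leq a0); rewrite leqNgt ap.
Qed.

Lemma prime_dvd_bin_pow (p e i : nat) : prime p -> (0 < i < p ^ e)%N ->
  (p %| 'C(p ^ e, i))%N.
Proof.
move=> pp ip; apply: (@prime_dvd_of_mul p e i _ 'C((p ^ e).-1, i.-1)) => //.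
move: ip; case: i => [//|i] ip.
have : (0 < p ^ e)%N by rewrite expn_gt0 prime_gt0.
by case: (p ^ e)%N => [//|q] _ /=; rewrite mul_bin_diag.
Qed.

(** For s = q + r with r + 1 < q, the identity (r+1) 'C(s, r+1) = q 'C(s, r) forces p to divide
    'C(s, r+1) = 'C(s, q-1). *)
Lemma prime_dvd_bin_pred (p e s : nat) : prime p -> (0 < e)%N ->
  (s < (2 * p ^ e).-1)%N -> s != (p ^ e).-1 -> (p %| 'C(s, (p ^ e).-1))%N.
Proof.
move=> pp e0; set q := (p ^ e)%N => sq sq'.
have q0 : (0 < q)%N by rewrite expn_gt0 prime_gt0.
case: (ltnP s q.-1) => [h|h]; first by rewrite bin_small.
have qs : (q <= s)%N by rewrite -(prednK q0) ltn_neqAle eq_sym sq'.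
set r := (s - q)%N; have E : s = (q + r)%N by rewrite subnKC.
have rq : (r.+1 < q)%N by move: sq; rewrite E; clear; lia.
rewrite -bin_sub // E (_ : (q + r - q.-1) = r.+1)%N; last by lia.
apply: (@prime_dvd_of_mul p e r.+1 _ 'C(q + r, r)) => //.
by rewrite mul_bin_left addnK.
Qed.

(** Vandermonde for q + (q-1): all terms but the first contain some 'C(q, i) with 0 < i < q, so the
    binomial is 1 mod p. *)
Lemma prime_ndvd_bin_pred (p e : nat) : prime p -> (0 < e)%N ->
  ~~ (p %| 'C((2 * p ^ e).-1, (p ^ e).-1))%N.
Proof.
move=> pp e0; set q := (p ^ e)%N.
have q0 : (0 < q)%N by rewrite expn_gt0 prime_gt0.
have -> : ((2 * q).-1 = q + q.-1)%N by lia.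
rewrite -binomial.Vandermonde big_ord_recl /= bin0 mul1n subn0 binn.
rewrite dvdn_addl ?dvdn1 ?gtn_eqF ?prime_gt1 //; apply: dvdn_sum => i _.
rewrite dvdn_mulr // prime_dvd_bin_pow // /bump /=; have := ltn_ord i.
by rewrite -/q; lia.
Qed.

(** The inclusion matrix of W against the (q-1)-subsets has Gram matrix 'C(#|A :&: B|, q-1). Over
    F_p this is diagonal with nonzero diagonal, so its rank #|W| is at most the number of
    columns. *)
Theorem frankl_wilson (n p e : nat) (W : {set {set 'I_n}}) :
  prime p -> (0 < e)%N ->
  (forall A, A \in W -> #|A| = (2 * p ^ e).-1) ->
  (forall A B, A \in W -> B \in W -> A != B -> #|A :&: B| != (p ^ e).-1) ->
  (#|W| <= 'C(n, (p ^ e).-1))%N.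
Proof.
move=> pp e0 Wcard Wint; set k := (p ^ e).-1.
pose D := [set J : {set 'I_n} | #|J| == k].
have cD : #|D| = 'C(n, k) by rewrite card_draws card_ord.
pose A : 'M['F_p]_(#|W|, #|D|) :=
  \matrix_(i < #|W|, j < #|D|) (enum_val j \subset enum_val i)%:R.
have AE i j : (A *m A^T) i j = ('C(#|enum_val i :&: enum_val j|, k))%:R.
  rewrite mxE.
  transitivity (\sum_(J in D) (J \subset enum_val i)%:R
      * (J \subset enum_val j)%:R : 'F_p).
    by rewrite [RHS]big_enum_val; apply: eq_bigr => l _; rewrite !mxE.
  rewrite -cards_draws -sum1_card natr_sum.
  rewrite big_mkcond [RHS]big_mkcond; apply: eq_bigr => J _.
  rewrite !inE finset.subsetI -natrM mulnb; case: (#|J| == k); rewrite ?andbT ?andbF //.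
  by case: (_ && _).
have F0 (m : nat) : ((m%:R : 'F_p) == 0) = (p %| m)%N.
  by rewrite -(dvdn_pcharf (pchar_Fp pp)).
have Gd : A *m A^T = diag_mx (\row_(i < #|W|) ('C(#|enum_val i|, k))%:R).
  apply/matrixP => i j; rewrite AE !mxE; case: eqVneq => [->|ij].
    by rewrite finset.setIid mulr1n.
  rewrite mulr0n; apply/eqP; rewrite F0.
  have iW := enum_valP i; have jW := enum_valP j.
  have neq : enum_val i != enum_val j by apply: contra ij => /eqP/enum_val_inj ->.
  apply: prime_dvd_bin_pred (Wint _ _ iW jW neq) => //.
  rewrite -(Wcard _ iW) ltn_neqAle subset_leq_card ?finset.subsetIl // andbT.
  apply: contra neq => /eqP cij; rewrite eqEcard (Wcard _ iW) (Wcard _ jW) leqnn.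
  rewrite andbT; apply/finset.setIidPl/eqP; rewrite eqEcard finset.subsetIl /= cij.
  by [].
have Gu : A *m A^T \in unitmx.
  rewrite unitmxE Gd det_diag unitfE; apply/prodf_neq0 => i _.
  by rewrite mxE F0 (Wcard _ (enum_valP i)) prime_ndvd_bin_pred.
rewrite -cD -(mxrank_unit Gu); apply: leq_trans (mxrankM_maxl _ _) _.
exact: rank_leq_col.
Qed.

End FranklWilson.

(** * Random subgraphs without large cliques *)

Lemma card_bigcup_le (I T : finType) (P : pred I) (F : I -> {set T}) :
  (#|\bigcup_(i | P i) F i| <= \sum_(i | P i) #|F i|)%N.
Proof.
apply: (big_ind2 (fun (A : {set T}) k => #|A| <= k)%N); rewrite ?cards0 // => A a B b hA hB.
by apply: (leq_trans (leq_card_setU A B)); exact: leq_add.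
Qed.

Section SparseSubgraph.
Variables (V : finType) (E : {set {set V}}) (s : nat).
Hypothesis E2 : forall S, S \in E -> #|S| = 2.
Hypothesis Es : forall I : {set V}, (forall S, S \in E -> ~~ (S \subset I)) -> (#|I| <= s)%N.

Definition edges_in (W : {set V}) : {set {set V}} := [set S in E | S \subset W].

Let nbhd (W : {set V}) (v : V) : {set V} :=
  [set y in W | (y != v) && ([set v; y] \in E)].

(** A maximal independent I inside W has at most s elements, and by maximality the closed
    neighbourhoods of its points cover W; one of them has at least #|W| / s elements. *)
Lemma card_le_max_degree (W : {set V}) : (0 < #|W|)%N ->
  exists2 v, v \in W & (#|W| <= s * (#|nbhd W v|).+1)%N.
Proof.
move=> W0; apply: contrapT => no.
pose P (I : {set V}) := (I \subset W) && [forall S in E, ~~ (S \subset I)].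
have P0 : P finset.set0.
  rewrite /P finset.sub0set /=; apply/forall_inP => S SE.
  by rewrite finset.subset0 -cards_eq0 (E2 S SE).
have [I /maxsetP[/andP[IW /forall_inP Ind] Imax] _] := maxset_exists P0.
have cov : W \subset \bigcup_(v in I) (v |: nbhd W v)%SET.
  apply/fintype.subsetP => w wW; apply/finset.bigcupP.
  case: (boolP (w \in I)) => wI; first by exists w => //; rewrite finset.setU11.
  have : ~~ P (w |: I)%SET.
    apply: contra wI => PwI.
    by rewrite -(Imax _ PwI (finset.subsetUr _ _)) finset.setU11.
  rewrite /P finset.subUset finset.sub1set wW IW /= negb_forall_in.
  move=> /exists_inP[S SE]; rewrite negbK => SwI.
  have wS : w \in S.
    apply: contraT => wS; have := Ind S SE; suff -> : S \subset I by [].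
    apply/fintype.subsetP => y yS.
    move/fintype.subsetP: SwI => /(_ y yS); rewrite !inE; case: eqP => // yw.
    by rewrite -yw yS in wS.
  have /cards2P[a [b [ab Sab]]] : #|S| == 2 by rewrite E2.
  have [v [vw Svw]] : exists v, v != w /\ S = [set v; w]%SET.
    move: wS; rewrite Sab !inE => /orP[] /eqP ->.
      by exists b; rewrite eq_sym finset.setUC.
    by exists a.
  have vI : v \in I.
    move/fintype.subsetP: SwI => /(_ v); rewrite Svw !inE eqxx (negbTE vw) /=.
    by move=> /(_ isT).
  by exists v => //; rewrite !inE wW eq_sym vw -Svw SE orbT.
have h1 : (#|W| <= \sum_(v in I) (#|nbhd W v|).+1)%N.
  apply: (leq_trans (subset_leq_card cov)).
  apply: (leq_trans (card_bigcup_le _ _ _ _)).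
  by apply: leq_sum => v _; rewrite cardsU1 -add1n leq_add2r leq_b1.
have h2 : (s * #|W| <= #|I| * #|W|.-1)%N.
  apply: leq_trans (leq_mul (leqnn s) h1) _.
  rewrite big_distrr /= -sum_nat_const; apply: leq_sum => v vI.
  have : ~~ (#|W| <= s * (#|nbhd W v|).+1)%N.
    apply/negP => h; apply: no; exists v => //.
    by move/fintype.subsetP: IW; exact.
  by rewrite -ltnNge; case: #|W| W0.
have Is := Es I Ind.
have : (#|I| * #|W|.-1 <= s * #|W|.-1)%N by rewrite leq_mul2r Is orbT.
move=> /(leq_trans h2); rewrite leq_mul2l.
have -> : (#|W| <= #|W|.-1)%N = false by rewrite -ltnS prednK // ltnn.
rewrite orbF => /eqP s0; move: Is; rewrite s0 leqn0 cards_eq0 => /eqP I0.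
by move: h1; rewrite I0 big_set0 leqNgt W0.
Qed.

(** Deleting a vertex of degree at least #|W| / s - 1 and iterating, the deleted degrees add up to
    at least #|W|^2 / (2 s) - #|W|. *)
Lemma turan_weak (W : {set V}) :
  (#|W| ^ 2 <= 2 * s * (#|edges_in W| + #|W|))%N.
Proof.
move: {2}#|W| (leqnn #|W|) => m; elim: m W => [|m IH] W Wm.
  by move: Wm; rewrite leqn0 => /eqP ->.
case: (posnP #|W|) => [->//|W0].
have [v vW hv] := card_le_max_degree W W0.
have cW : #|W| = (#|(W :\ v)%SET|).+1 by rewrite (cardsD1 v W) vW.
have := IH (W :\ v)%SET; rewrite -ltnS -cW => /(_ Wm) IH'.
have hE : (#|edges_in (W :\ v)%SET| + #|nbhd W v| <= #|edges_in W|)%N.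
  pose g (y : V) : {set V} := [set v; y]%SET.
  have ginj : {in nbhd W v &, injective g}.
    move=> x y; rewrite !inE => /and3P[_ xv _] _ /setP /(_ x).
    by rewrite !inE eqxx orbT (negbTE xv) => /esym /eqP.
  rewrite -(card_in_imset ginj) -leq_subRL ?leq_addr //; last first.
    by apply: subset_leq_card; apply/fintype.subsetP => S; rewrite !inE =>
      /andP[-> /fintype.subset_trans -> //]; exact: finset.subsetDl.
  have <- : #|edges_in W :\: edges_in (W :\ v)%SET| =
            (#|edges_in W| - #|edges_in (W :\ v)%SET|)%N.
    rewrite cardsD; congr (_ - #|pred_of_set _|)%N; apply/finset.setIidPr.
    by apply/fintype.subsetP => S; rewrite !inE => /andP[-> /fintype.subset_trans -> //];
       exact: finset.subsetDl.
  apply: subset_leq_card; apply/fintype.subsetP => S /imsetP[y].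
  rewrite !inE => /and3P[yW yv SE] ->; rewrite SE /= !finset.subUset !finset.sub1set !inE vW yW.
  by rewrite eqxx.
have := leq_mul (leqnn (2 * s)%N) hE; move: IH' hv; rewrite cW.
move: #|edges_in _| #|nbhd _ _| #|edges_in _| #|(_ :\ _)%SET|.
by move=> a b c d; nia.
Qed.

End SparseSubgraph.

(** * First-moment argument for a random set of edges *)

Section RandomEdges.
Variables (R : realFieldType) (V : finType) (pr : R).
Hypotheses (pr0 : 0 <= pr) (pr1 : pr <= 1).

Let bit (b : bool) : R := if b then pr else 1 - pr.

Let bit_ge0 (b : bool) : 0 <= bit b.
Proof. by rewrite /bit; case: b; rewrite ?subr_ge0. Qed.

(** The product measure in which every subset of V, edge or not, is kept with probability pr. A
    k-set then counts as a clique when all its pairs are kept, which can only overcount the cliques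
    of the graph. *)
Let weight (w : {ffun {set V} -> bool}) : R := \prod_S bit (w S).

Let weight_ge0 (w : {ffun {set V} -> bool}) : 0 <= weight w.
Proof. by apply: prodr_ge0 => S _. Qed.

Let prob_forall (F : {set {set V}}) (b : bool) :
  \sum_w weight w * [forall S in F, w S == b]%:R = bit b ^+ #|F|.
Proof.
have -> : bit b ^+ #|F| =
    \prod_S \sum_(x : bool) bit x * ((S \in F) ==> (x == b))%:R.
  transitivity (\prod_S (if S \in F then bit b else 1)).
    by rewrite -big_mkcond prodr_const.
  apply: eq_bigr => S _; rewrite big_bool /=; case: (S \in F) => /=.
    by case: b; rewrite /= mulr1 mulr0 ?addr0 ?add0r.
  by rewrite !mulr1 /bit; ring.
rewrite bigA_distr_bigA; apply: eq_bigr => w _; rewrite big_split; congr (_ * _).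
rewrite -[RHS]natr_prod; congr _%:R.
case: (boolP [forall S in F, w S == b]) => [/forall_inP h|].
  by rewrite big1 // => S _; case: (boolP (S \in F)) => // /h ->.
rewrite negb_forall_in => /exists_inP[S SF wS].
by rewrite (bigD1 S) //= SF (negbTE wS).
Qed.

Let sum_weight : \sum_w weight w = 1.
Proof.
rewrite -(expr0 (bit true)) -(cards0 {set V}) -prob_forall; apply: eq_bigr => w _.
rewrite (_ : [forall S in _, _] = true) ?mulr1 //.
by apply/forall_inP => S; rewrite inE.
Qed.

Lemma bin_le_expn (n k : nat) : ('C(n, k) <= n ^ k)%N.
Proof.
elim: k n => [|k IH] [|n]; rewrite ?bin0 ?expn0 ?bin0n //.
have h := mul_bin_diag n.+1 k; apply: (@leq_trans (k.+1 * 'C(n.+1, k.+1))).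
  by rewrite leq_pmull.
rewrite -h expnS leq_mul //= (leq_trans (IH n)) //.
by case: (k) => [//|j]; rewrite leq_exp2r.
Qed.

Let pairs (K : {set V}) : {set {set V}} := [set S : {set V} | S \subset K & #|S| == 2].

(** X counts the k-sets with all pairs kept, Y the m-sets without a kept edge. The mean of 2 X / N +
    Y is at most 1/2 + 1/4, so it is below 1 for some outcome; there Y, being an integer, is 0 and 2
    X < N. *)
Lemma random_edges (E : {set {set V}}) (k m : nat) : (0 < #|V|)%N ->
  4 * #|V|%:R ^+ k * pr ^+ 'C(k, 2) <= #|V|%:R ->
  (forall W : {set V}, #|W| = m ->
     4 * #|V|%:R ^+ m * (1 - pr) ^+ #|edges_in V E W| <= 1) ->
  exists w : {ffun {set V} -> bool},
    (forall W : {set V}, #|W| = m -> exists2 S, S \in edges_in V E W & w S) /\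
    (2 * #|[set K : {set V} | #|K| == k & [forall S in pairs K, w S]]| <= #|V|)%N.
Proof.
set N := #|V| => N0 hX hY; have N0' : (0 : R) < N%:R by rewrite ltr0n.
pose X (w : {ffun {set V} -> bool}) : R :=
  \sum_(K : {set V} | #|K| == k) [forall S in pairs K, w S == true]%:R.
pose Y (w : {ffun {set V} -> bool}) : R :=
  \sum_(W : {set V} | #|W| == m) [forall S in edges_in V E W, w S == false]%:R.
have cards (j : nat) (z : R) : 0 <= z ->
    \sum_(W : {set V} | #|W| == j) z <= N%:R ^+ j * z.
  move=> z0; rewrite sumr_const -[leLHS]mulr_natl ler_wpM2r // -natrX ler_nat.
  by rewrite -cardsE card_draws bin_le_expn.
have EX : \sum_w weight w * X w <= N%:R ^+ k * pr ^+ 'C(k, 2).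
  rewrite /X; under eq_bigr do rewrite mulr_sumr.
  rewrite exchange_big /=; apply: le_trans (cards k _ _); last by rewrite exprn_ge0.
  by apply: ler_sum => K /eqP cK; rewrite prob_forall cards_draws cK.
have EY : \sum_w weight w * Y w <= 1 / 4.
  rewrite /Y; under eq_bigr do rewrite mulr_sumr.
  rewrite exchange_big /=.
  apply: (@le_trans _ _ (\sum_(W : {set V} | #|W| == m) (4 * N%:R ^+ m)^-1)).
    apply: ler_sum => W /eqP cW; rewrite prob_forall /=.
    rewrite -[leRHS]mul1r ler_pdivlMr ?mulr_gt0 ?exprn_gt0 //.
    by rewrite mulrC; exact: hY.
  apply: le_trans (cards m _ _) _.
    by rewrite invr_ge0 mulr_ge0 ?exprn_ge0 // ltW.
  by rewrite invfM mulrCA divff ?mulr1 ?expf_neq0 ?gt_eqF //; lra.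
apply: contrapT => no.
have big w : 1 <= 2 / N%:R * X w + Y w.
  case: (boolP [exists W : {set V},
      (#|W| == m) && [forall S in edges_in V E W, w S == false]]) => [|noW].
    move=> /existsP[W /andP[cW hW]].
    have Y1 : 1 <= Y w.
      rewrite /Y (bigD1 W) //= hW lerDl sumr_ge0 //.
    have X0 : 0 <= X w by rewrite sumr_ge0.
    by have : 0 <= 2 / N%:R * X w; [rewrite mulr_ge0 // divr_ge0 ?ltW|lra].
  have Y0 : 0 <= Y w by rewrite sumr_ge0.
  suff : 1 <= 2 / N%:R * X w by lra.
  rewrite mulrAC ler_pdivlMr // mul1r leNgt; apply/negP => XN.
  apply: no; exists w; split.
    move=> W cW; apply: contrapT => noS; move/negP: noW; apply.
    apply/existsP; exists W; rewrite cW eqxx; apply/forall_inP => S SE.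
    by apply/eqP/negbTE/negP => wS; apply: noS; exists S.
  rewrite -(ler_nat R) natrM; apply: le_trans (ltW XN); rewrite ler_wpM2l //.
  rewrite -sum1_card natr_sum /X big_mkcond [leRHS]big_mkcond; apply: ler_sum => K _.
  rewrite !inE; case: (#|K| == k) => //=; case: ifP => // /forall_inP h.
  by rewrite (_ : [forall _ in _, _] = true) //; apply/forall_inP => S /h ->.
have : \sum_w weight w * 1 <= \sum_w weight w * (2 / N%:R * X w + Y w).
  by apply: ler_sum => w _; rewrite ler_wpM2l.
under eq_bigr do rewrite mulr1; rewrite sum_weight.
under [leRHS]eq_bigr do rewrite mulrDr mulrCA.
rewrite big_split -mulr_sumr /=.
have : 2 / N%:R * (\sum_w weight w * X w) <= 1 / 2.
  apply: le_trans (ler_wpM2l _ EX) _; first by rewrite divr_ge0 ?ltW.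
  by rewrite mulrAC ler_pdivrMr //; lra.
by lra.
Qed.

Lemma exists_subset_card (A : {set V}) (m : nat) : (m <= #|A|)%N ->
  exists2 W : {set V}, W \subset A & #|W| = m.
Proof.
move=> mA; exists [set x in take m (enum A)].
  by apply/fintype.subsetP => x; rewrite inE => /mem_take; rewrite mem_enum.
by rewrite cardsE (card_uniqP _) ?take_uniq ?enum_uniq // size_takel // -cardE.
Qed.

(* Deleting one vertex from each k-clique of a random subgraph leaves at least
   half of the vertices, and every colour class has fewer than [m] elements. *)
Lemma random_clique_free (E : {set {set V}}) (k m : nat) :
  (0 < #|V|)%N -> (0 < k)%N -> (0 < m)%N ->
  4 * #|V|%:R ^+ k * pr ^+ 'C(k, 2) <= #|V|%:R ->
  (forall W : {set V}, #|W| = m ->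
     4 * #|V|%:R ^+ m * (1 - pr) ^+ #|edges_in V E W| <= 1) ->
  exists (w : pred {set V}) (V' : {set V}),
    (forall K : {set V}, K \subset V' -> #|K| = k ->
       exists S : {set V}, [/\ S \subset K, #|S| = 2 & ~~ w S]) /\
    (forall (c : nat) (f : V -> nat), (forall x, x \in V' -> (f x < c)%N) ->
       (forall S, S \in E -> w S -> S \subset V' ->
          exists x y, [/\ x \in S, y \in S & f x <> f y]) ->
       (#|V| <= 2 * (c * m))%N).
Proof.
move=> N0 k0 m0 hX hY; have [w [wE wK]] := random_edges E k m N0 hX hY.
set KK := [set K : {set V} | _ & _] in wK.
(* [[pick y in K]] selects the vertex to delete; each K contributes at most one point. *)
pose D := (\bigcup_(K in KK) [set x | [pick y in K] == Some x])%SET.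
have cD : (#|D| <= #|KK|)%N.
  apply: leq_trans (card_bigcup_le _ _ _ _) _; rewrite -sum1_card.
  apply: leq_sum => K _; case: pickP => [x _|_].
    by rewrite (_ : [set _ | _] = [set x]%SET) ?cards1 //;
       apply/setP => y; rewrite !inE eq_sym.
  by rewrite (_ : [set _ | _] = finset.set0) ?cards0 //; apply/setP => y; rewrite !inE.
exists w, (~: D)%SET; split.
  move=> K KD cK; apply: contrapT => no.
  have KKK : K \in KK.
    rewrite inE cK eqxx; apply/forall_inP => S; rewrite inE => /andP[SK /eqP cS].
    by apply: contraT => nS; case: no; exists S.
  have [x xK] : exists x, [pick y in K] = Some x.
    case: pickP => [x xK|h]; first by exists x.
    by move: k0; rewrite -cK (eq_card0 h).
  have xD : x \in D by apply/finset.bigcupP; exists K => //; rewrite inE xK.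
  have : x \in K by move: xK; case: pickP => // y yK [<-].
  by move/fintype.subsetP: KD => /(_ x) /[apply]; rewrite inE xD.
move=> c f fc fE.
have cl (i : nat) : (#|[set x in (~: D)%SET | f x == i]| <= m)%N.
  rewrite leqNgt; apply/negP => /ltnW/exists_subset_card[W Wsub cW].
  have [S /[!inE] /andP[SE SW] wS] := wE W cW.
  have SV : S \subset (~: D)%SET.
    apply: fintype.subset_trans SW (fintype.subset_trans Wsub _).
    by apply/fintype.subsetP => x; rewrite inE => /andP[].
  have [x [y [xS yS]]] := fE S SE wS SV; apply.
  have fi z : z \in S -> f z = i.
    move=> zS; have : z \in [set x in (~: D)%SET | f x == i].
      by apply: (fintype.subsetP Wsub); exact: (fintype.subsetP SW).
    by rewrite inE => /andP[_ /eqP].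
  by rewrite !fi.
have cV : (#|(~: D)%SET| <= c * m)%N.
  have sub : (~: D)%SET \subset (\bigcup_(i < c) [set x in (~: D)%SET | f x == i])%SET.
    apply/fintype.subsetP => x xD; apply/finset.bigcupP.
    by exists (Ordinal (fc x xD)) => //; rewrite inE xD eqxx.
  apply: (leq_trans (subset_leq_card sub)).
  apply: (leq_trans (card_bigcup_le _ _ _ _)).
  apply: (@leq_trans (\sum_(i < c) m)); first by apply: leq_sum => i _; exact: cl.
  by rewrite sum_nat_const card_ord.
have := cardsC D; move: cD wK cV; rewrite -/KK.
by move: #|D| #|(~: D)%SET| #|KK| #|V| (c * m)%N => a b d e g; lia.
Qed.

End RandomEdges.

(** * Distance graphs *)

Section IndicatorVectors.
Variables (R : realType) (n : nat).

Definition indic_vec (A : {set 'I_n}) : 'rV[R]_n := \row_i (i \in A)%:R.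

Lemma indic_vec_inj : injective indic_vec.
Proof.
move=> A B AB; apply/setP => i; move/rowP: AB => /(_ i); rewrite !mxE.
by case: (i \in A); case: (i \in B) => // /eqP; rewrite ?oner_eq0 // eq_sym oner_eq0.
Qed.

Lemma eucl_norm_indic_vec (A B : {set 'I_n}) :
  eucl_norm (indic_vec A - indic_vec B)
  = Num.sqrt (#|A|%:R + #|B|%:R - 2 * #|A :&: B|%:R).
Proof.
rewrite /eucl_norm; congr Num.sqrt.
have card (C : {set 'I_n}) : #|C|%:R = \sum_(i < n) (i \in C)%:R :> R.
  by rewrite -sum1_card natr_sum big_mkcond; apply: eq_bigr => i _; case: (i \in C).
rewrite !card mulr_sumr -big_split -sumrB; apply: eq_bigr => i _ /=.
rewrite !mxE inE; case: (i \in A); case: (i \in B) => /=; ring.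
Qed.

End IndicatorVectors.

Section CliqueFreeDistanceGraph.
Variable R : realType.

Lemma clique_number_lt (T : Type) (G : graph T) (k : nat) :
  (forall (A : set T) m, clique G A -> (A #= `I_m)%card -> (m <= k)%N) ->
  (clique_number R G < k.+1%:R%:E)%E.
Proof.
move=> h; apply: (@le_lt_trans _ _ (k%:R%:E)); last by rewrite lte_fin ltr_nat.
apply: ge_ereal_sup => _ [m [A [cA Am]] <-].
by rewrite lee_fin ler_nat (h A).
Qed.

Lemma chromatic_number_ge (T : Type) (G : graph T) (z : R) :
  (forall m, colorable G m -> z <= m%:R) -> (z%:E <= chromatic_number R G)%E.
Proof.
by move=> h; apply: le_ereal_inf_tmp => _ [m cm <-]; rewrite lee_fin h.
Qed.

(** Serves the dimensions below the threshold and the case of an empty [c_set]. A vertex is required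
    because the empty graph has chromatic number 0. *)
Lemma one_vertex_graph (n k : nat) : exists G : graph 'rV[R]_n,
  [/\ distance_graph G, (clique_number R G < k.+2%:R%:E)%E &
      (1%:E <= chromatic_number R G)%E].
Proof.
pose G := @Graph 'rV[R]_n [set 0]%classic (fun _ _ => False)
  (fun _ _ h => h) (fun _ h => h) (fun _ _ h => False_ind _ h).
exists G; split; first by exists 1; split.
  apply: clique_number_lt => A m [A0 _] Am.
  suff : (m <= 1)%N by move/leq_trans; apply.
  rewrite leqNgt; apply/negP => m1.
  have /card_set_bijP[g [gfun ginj _]] : (`I_m #= A)%card by rewrite card_eq_sym.
  have g0 i : (i < m)%N -> g i = 0 by move=> im; apply: (A0 _ (gfun i im)).
  have : 0%N = 1%N.
    by apply: ginj; rewrite ?inE //= ?g0 //; apply: leq_trans m1.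
  by [].
apply: chromatic_number_ge => -[|m] [f [fm _]]; last by rewrite ler1n.
by have := fm 0 erefl.
Qed.

(** Joined sets are at squared distance 2 (2q-1) - 2 (q-1) = 2q. The number d of edges inside an
    m-set is known only through [turan_weak], so the last hypothesis ranges over all d that satisfy
    that inequality. *)
Lemma clique_free_distance_graph (n p e k m : nat) (pr : R) :
  let q := (p ^ e)%N in let N := 'C(n, (2 * q).-1) in
  prime p -> (0 < e)%N -> (0 < m)%N -> 0 <= pr <= 1 -> (0 < N)%N ->
  4 * N%:R ^+ k.+1 * pr ^+ 'C(k.+1, 2) <= N%:R ->
  (forall d : nat, (m ^ 2 <= 2 * 'C(n, q.-1) * (d + m))%N ->
    4 * N%:R ^+ m * (1 - pr) ^+ d <= 1) ->
  exists G : graph 'rV[R]_n,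
    [/\ distance_graph G, (clique_number R G < k.+1%:R%:E)%E &
        forall c, colorable G c -> (N <= 2 * (c * m))%N].
Proof.
move=> q N pp e0 m0 /andP[pr0 pr1] N0 hX hY.
have q0 : (0 < q)%N by rewrite expn_gt0 prime_gt0.
pose V := {A : {set 'I_n} | #|A| == (2 * q).-1}.
have cV : #|{: V}| = N by rewrite card_sig -cardsE card_draws card_ord.
pose E : {set {set V}} := [set S | [exists A, exists B,
  [&& A != B, S == [set A; B]%SET & #|val A :&: val B| == q.-1]]].
have EP (S : {set V}) : S \in E -> exists A B,
    [/\ A != B, S = [set A; B]%SET & #|val A :&: val B| = q.-1].
  rewrite inE => /existsP[A /existsP[B /and3P[AB /eqP SAB /eqP cAB]]].
  by exists A, B.
have E2 S : S \in E -> #|S| = 2 by move=> /EP[A [B [AB -> _]]]; rewrite cards2 AB.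
have Es (I : {set V}) : (forall S, S \in E -> ~~ (S \subset I)) ->
    (#|I| <= 'C(n, q.-1))%N.
  move=> ind; rewrite -(card_imset _ val_inj); apply: frankl_wilson => //.
    by move=> _ /imsetP[A _ ->]; apply/eqP; exact: (valP A).
  move=> _ _ /imsetP[A AI ->] /imsetP[B BI ->] AB; apply/negP => cAB.
  have : [set A; B]%SET \in E.
    rewrite inE; apply/existsP; exists A; apply/existsP; exists B.
    by rewrite eqxx cAB !andbT; apply: contra AB => /eqP ->.
  by move=> /ind; rewrite finset.subUset !finset.sub1set AI BI.
have [w [V' [noclique col]]] := @random_clique_free R V pr pr0 pr1 E k.+1 m
  ltac:(by rewrite cV) isT m0 ltac:(by rewrite cV)
  ltac:(by move=> W cW; rewrite cV; apply: hY; rewrite -cW; exact: turan_weak).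
pose vec (A : V) : 'rV[R]_n := indic_vec R n (val A).
have vec_inj : injective vec by move=> A B /indic_vec_inj /val_inj.
pose adjac (x y : 'rV[R]_n) := exists A B : V, [/\ x = vec A, y = vec B,
  A \in V', B \in V' & ([set A; B]%SET \in E) && w [set A; B]%SET].
have adj_sym x y : adjac x y -> adjac y x.
  by move=> [A [B [xA yB AV BV h]]]; exists B, A; rewrite finset.setUC.
have adj_irr x : ~ adjac x x.
  move=> [A [B [-> /vec_inj -> _ _ /andP[/E2]]]].
  by rewrite finset.setUid cards1.
pose verts : set 'rV[R]_n := [set vec A | A in [set A | A \in V']]%classic.
have adj_v x y : adjac x y -> verts x /\ verts y.
  by move=> [A [B [-> -> AV BV _]]]; split; [exists A|exists B].
exists (Graph adj_sym adj_irr adj_v); split.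
- exists (Num.sqrt (2 * q)%:R); split; first by rewrite sqrtr_gt0 ltr0n muln_gt0.
  move=> x y [A [B [-> -> _ _ /andP[/EP[A' [B' [AB' AB cAB]]] _]]]].
  have cI : #|val A :&: val B| = q.-1.
    have : A' \in [set A; B]%SET by rewrite AB !inE eqxx.
    have : B' \in [set A; B]%SET by rewrite AB !inE eqxx orbT.
    rewrite !inE => /orP[] /eqP EB /orP[] /eqP EA; move: AB' cAB;
      rewrite EA EB ?eqxx // => _.
    by rewrite finset.setIC.
  rewrite eucl_norm_indic_vec cI (eqP (valP A)) (eqP (valP B)); congr Num.sqrt.
  have -> : ((2 * q).-1 = q + q.-1)%N by rewrite mul2n -addnn -{2}(prednK q0) addnS.
  by rewrite natrM !natrD; ring.
- apply: clique_number_lt => C j [CV Cadj] Cj; rewrite leqNgt; apply/negP => kj.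
  have /card_set_bijP[g [gfun ginj _]] : (`I_j #= C)%card by rewrite card_eq_sym.
  have gV (i : 'I_j) : {A : V | A \in V' & vec A = g i}.
    apply: cid2; have [A AV gA] := CV _ (gfun i (ltn_ord i)).
    by exists A.
  pose h (i : 'I_j) : V := s2val (gV i).
  have hV i : h i \in V' by rewrite /h; case: (gV i).
  have hg i : vec (h i) = g i by rewrite /h; case: (gV i).
  have hinj : injective h.
    move=> i1 i2 h12; apply: ord_inj; apply: ginj; rewrite ?inE //=.
    by rewrite -!hg h12.
  have [K Ksub cK] : exists2 K : {set V}, K \subset (h @: [set: 'I_j])%SET & #|K| = k.+1.
    by apply: exists_subset_card; rewrite card_imset // cardsT card_ord.
  have Kh A : A \in K -> exists i, A = h i.
    by move/(fintype.subsetP Ksub) => /imsetP[i _ ->]; exists i.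
  have KV : K \subset V' by apply/fintype.subsetP => A /Kh[i ->].
  have [S [SK cS wS]] := noclique K KV cK.
  have /cards2P[A [B [AB SAB]]] : #|S| == 2 by rewrite cS.
  have [iA EA] : exists i, A = h i.
    by apply: Kh; apply: (fintype.subsetP SK); rewrite SAB !inE eqxx.
  have [iB EB] : exists i, B = h i.
    by apply: Kh; apply: (fintype.subsetP SK); rewrite SAB !inE eqxx orbT.
  have : adjac (vec A) (vec B).
    apply: Cadj; [by rewrite EA hg; exact: (gfun _ (ltn_ord _))|by rewrite EB hg; exact: (gfun _ (ltn_ord _))|].
    by move/vec_inj/eqP; rewrite (negbTE AB).
  move=> [A1 [B1 [/vec_inj <- /vec_inj <- _ _ /andP[_]]]].
  by rewrite -SAB (negbTE wS).
move=> c [f [fc fadj]]; rewrite -cV; apply: (col c (f \o vec)).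
  by move=> A AV; apply: fc; exists A.
move=> S SE wS SV; have [A [B [AB SAB _]]] := EP S SE.
exists A, B; rewrite SAB !inE !eqxx orbT; split=> //=; apply: fadj.
exists A, B; rewrite -SAB SE wS; split=> //; apply: (fintype.subsetP SV).
  by rewrite SAB !inE eqxx.
by rewrite SAB !inE eqxx orbT.
Qed.

End CliqueFreeDistanceGraph.

(** * Asymptotics *)

Section BinomialEntropy.
Context {R : realType}.

Definition entropy (b : R) : R := - (b * ln b) - (1 - b) * ln (1 - b).

Lemma entropy_gt0 (b : R) : 0 < b < 1 -> 0 < entropy b.
Proof.
move=> /andP[b0 b1]; have h1 : ln b < 0 by rewrite ln_lt0 // b0.
have h2 : ln (1 - b) < 0 by rewrite ln_lt0 //; lra.
by rewrite /entropy; nra.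
Qed.

Lemma tau0_gt0 (b : R) : 0 < b < 1 -> 0 < tau0 b.
Proof. by move=> ?; rewrite /tau0 mulr_gt0 ?powR_gt0 //; lra. Qed.

Lemma ln_tau0 (b : R) : 0 < b < 1 -> ln (tau0 b) = entropy (b / 2).
Proof.
move=> ?; rewrite /tau0 lnM ?posrE ?powR_gt0 ?ln_powR /entropy; [ring|lra..].
Qed.

Lemma tau1_gt0 (b : R) : 0 < b < 1 -> 0 < tau1 b.
Proof. by move=> ?; rewrite /tau1 mulr_gt0 ?powR_gt0 //; lra. Qed.

Lemma ln_tau1 (b : R) : 0 < b < 1 -> ln (tau1 b) = entropy b.
Proof.
move=> ?; rewrite /tau1 lnM ?posrE ?powR_gt0 ?ln_powR /entropy; [ring|lra..].
Qed.

(** The binomial law with parameters n and b. *)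
Let term (b : R) (n j : nat) : R := 'C(n, j)%:R * (b ^+ j * (1 - b) ^+ (n - j)).

Let term_ge0 (b : R) (n j : nat) : 0 < b < 1 -> 0 <= term b n j.
Proof. by move=> ?; rewrite /term !mulr_ge0 ?exprn_ge0 //; lra. Qed.

Let sum_term (b : R) (n : nat) : \sum_(j < n.+1) term b n j = 1.
Proof.
rewrite -[RHS](expr1n _ n) -[X in X ^+ n](subrK b) exprDn; apply: eq_bigr => j _.
by rewrite /term mulr_natl [b ^+ _ * _]mulrC.
Qed.

Let ln_term (b : R) (n j : nat) : 0 < b < 1 -> (j <= n)%N ->
  ln (term b n j) = ln 'C(n, j)%:R + (j%:R * ln b + (n - j)%:R * ln (1 - b)).
Proof.
move=> b01 jn; have b0 : 0 < b by lra.
have b1 : 0 < 1 - b by lra.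
have C0 : (0 : R) < 'C(n, j)%:R by rewrite ltr0n bin_gt0.
rewrite /term !lnM ?posrE ?mulr_gt0 ?exprn_gt0 // !lnXn //.
by rewrite -[ln b *+ j]mulr_natl -[ln (1 - b) *+ _]mulr_natl.
Qed.

(** A single binomial probability is at most 1, and since b <= 1 - b, lowering j below n b only
    increases b^j (1-b)^(n-j). *)
Lemma ln_bin_le (b : R) (n j : nat) : 0 < b -> b <= 1 / 2 -> (j <= n)%N ->
  j%:R <= n%:R * b -> ln 'C(n, j)%:R <= n%:R * entropy b.
Proof.
move=> b0 b2 jn jb; have b01 : 0 < b < 1 by lra.
have : term b n j <= 1.
  rewrite -(sum_term b n) (bigD1 (Ordinal (jn : (j < n.+1)%N))) //= lerDl.
  by rewrite sumr_ge0 // => i _; exact: term_ge0.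
move=> /ln_le0; rewrite (ln_term b n j b01 jn) natrB //.
have : ln b <= ln (1 - b) by rewrite ler_ln ?posrE; lra.
by rewrite /entropy => h1 h2; nra.
Qed.

Let term_step (b : R) (n j : nat) : (j < n)%N ->
  term b n j.+1 * (j.+1%:R * (1 - b)) = term b n j * ((n - j)%:R * b).
Proof.
move=> jn; rewrite /term (_ : (n - j = (n - j.+1).+1)%N); last by lia.
have h : j.+1%:R * 'C(n, j.+1)%:R = (n - j)%:R * 'C(n, j)%:R :> R.
  by rewrite -!natrM mul_bin_left.
transitivity ((j.+1%:R * 'C(n, j.+1)%:R) * (b ^+ j.+1 * (1 - b) ^+ (n - j.+1).+1)).
  by rewrite (exprS (1 - b) (n - j.+1)); ring.
rewrite h (_ : (n - j = (n - j.+1).+1)%N); last by lia.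
by rewrite [b ^+ j.+1]exprS; ring.
Qed.

(** The two conditions make a the mode of the binomial law, so its probability is at least 1 /
    (n+1). The term ln (1 - b) - ln b pays for a >= n b - 1 in place of a = n b. *)
Lemma ln_bin_ge (b : R) (n a : nat) : 0 < b -> b < 1 / 2 -> (a <= n)%N ->
  a%:R <= n.+1%:R * b -> n.+1%:R * b <= a%:R + 1 ->
  n%:R * entropy b - ln n.+1%:R - (ln (1 - b) - ln b) <= ln 'C(n, a)%:R.
Proof.
move=> b0 b2 an ab ba; have b01 : 0 < b < 1 by lra.
have up j : (j < a)%N -> term b n j <= term b n j.+1.
  move=> ja; have jn : (j < n)%N by exact: leq_trans ja an.
  have j1 : (0 : R) < j.+1%:R by rewrite ltr0n.
  have ja' : j.+1%:R <= a%:R :> R by rewrite ler_nat.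
  have t0 := term_ge0 b n j b01.
  have p0 : 0 < j.+1%:R * (1 - b) by rewrite mulr_gt0 //; lra.
  rewrite -(ler_pM2r p0) term_step // ler_wpM2l //.
  move: ab ja'; rewrite natrB ?(ltnW jn) // -!natr1 => h1 h2; nra.
have down j : (a <= j)%N -> (j < n)%N -> term b n j.+1 <= term b n j.
  move=> aj jn; have j1 : (0 : R) < j.+1%:R by rewrite ltr0n.
  have ja' : a%:R <= j%:R :> R by rewrite ler_nat.
  have t0 := term_ge0 b n j b01.
  have p0 : 0 < j.+1%:R * (1 - b) by rewrite mulr_gt0 //; lra.
  rewrite -(ler_pM2r p0) term_step // ler_wpM2l //.
  move: ba ja'; rewrite natrB ?(ltnW jn) // -!natr1 => h1 h2; nra.
have upto i : (i <= a)%N -> term b n (a - i) <= term b n a.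
  elim: i => [|i IH] ia; first by rewrite subn0.
  apply: le_trans (IH (ltnW ia)); rewrite -(subnSK ia); apply: up.
  by rewrite ltn_subrL (leq_trans _ ia).
have downto i : (a + i <= n)%N -> term b n (a + i) <= term b n a.
  elim: i => [|i IH] ia; first by rewrite addn0.
  rewrite addnS; apply: le_trans (IH _); last by rewrite ltnW // -addnS.
  by apply: down; [exact: leq_addr|rewrite -addnS].
have mode j : (j <= n)%N -> term b n j <= term b n a.
  move=> jn; case: (leqP j a) => [ja|aj]; first by rewrite -(subKn ja) upto ?leq_subr.
  by have := downto (j - a)%N; rewrite subnKC ?(ltnW aj) //; apply.
have n1 : (0 : R) < n.+1%:R by rewrite ltr0n.
have T1 : 1 <= n.+1%:R * term b n a.
  rewrite -[leLHS](sum_term b n) mulr_natl -[n.+1 in leRHS]card_ord -sumr_const.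
  by apply: ler_sum => j _; apply: mode; rewrite -ltnS.
have t0 : 0 < term b n a by rewrite -(pmulr_rgt0 _ n1) (lt_le_trans ltr01).
have := ln_ge0 T1; rewrite lnM ?posrE // (ln_term b n a b01 an) natrB //.
have : ln b <= ln (1 - b) by rewrite ler_ln ?posrE; lra.
move: ba; rewrite -natr1 /entropy; set L := ln (n%:R + 1) => h1 h2 h3; nra.
Qed.

Lemma ln_growth (a b c : R) : 0 < a -> 0 <= b ->
  exists n0 : nat, forall n, (n0 <= n)%N -> b * ln n.+1%:R + c <= a * n%:R.
Proof.
move=> a0 b0; pose d := a / (2 * (b + 1)).
have d0 : 0 < d by rewrite divr_gt0 //; lra.
exists (Num.truncn (2 / a * (c + a / 2 + b * (- 1 - ln d)))).+1 => n nn.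
have {nn} : 2 / a * (c + a / 2 + b * (- 1 - ln d)) <= n%:R.
  by apply: (le_trans (ltW (truncnS_gt _))); rewrite ler_nat.
rewrite mulrAC ler_pdivrMr // => hn.
have n1 : (0 : R) < n.+1%:R by rewrite ltr0n.
have := @ln_le_sub1 R (d * n.+1%:R) (mulr_gt0 d0 n1).
rewrite lnM ?posrE // => hl.
have bl : b * ln n.+1%:R <= b * (d * n.+1%:R - 1 - ln d).
  by rewrite ler_wpM2l //; lra.
have bd : b * d * n.+1%:R <= a / 2 * n.+1%:R.
  rewrite ler_wpM2r // /d mulrA ler_pdivrMr; [nra|lra].
move: bd bl; set y := ln _; rewrite -natr1; lra.
Qed.

End BinomialEntropy.

(** * Choice of the parameters in large dimension *)

Section LargeDimension.
Variable R : realType.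

Lemma double_bin2 (k : nat) : (2 * 'C(k.+2, 2) = k.+2 * k.+1)%N.
Proof. by rewrite -mul_bin_diag bin1. Qed.

Lemma exp_mul_ln (x : R) (n : nat) : 0 < x -> x ^+ n = expR (n%:R * ln x).
Proof. by move=> x0; rewrite expRM_natl lnK. Qed.

Lemma prime_power_near (b0 l : R) : 0 < b0 -> 1 < l ->
  exists n0 : nat, forall n, (n0 <= n)%N -> exists p e : nat,
    [/\ prime p, (0 < e)%N, b0 * n%:R / (2 * l) < (p ^ e)%:R &
        (p ^ e)%:R <= b0 * n%:R / 2].
Proof.
move=> b00 l1; have [X X1 hX] := prime_power_in_interval l l1.
exists (Num.truncn (X * (2 * l) / b0)).+1 => n nn.
have Xn : X <= b0 * n%:R / (2 * l).
  rewrite ler_pdivlMr; last by lra.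
  rewrite [leRHS]mulrC -ler_pdivrMr //.
  by apply: (le_trans (ltW (truncnS_gt _))); rewrite ler_nat.
have [p [e [pp e0 /andP[h1 h2]]]] := hX _ Xn.
exists p, e; split=> //; apply: (le_trans h2).
by rewrite le_eqVlt; apply/orP; left; apply/eqP; field; rewrite gt_eqF //; lra.
Qed.

(** Origin of the condition on k: with K = k.+2, dividing by N leaves 4 N^(K-1) pr^(K(K-1)/2), whose
    main part is the power (K-1)/2 of N^2 pr^K. The linear condition on ln pr says that N^2 pr^K is
    at most 1/16, which absorbs the 4. *)
Lemma expected_cliques_le (N k n : nat) (h pr : R) : (0 < N)%N -> 0 < pr ->
  ln N%:R <= n%:R * h ->
  k.+2%:R * ln pr <= - (2 * (n%:R * h)) - 2 * ln 4 ->
  4 * N%:R ^+ k.+2 * pr ^+ 'C(k.+2, 2) <= N%:R.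
Proof.
move=> N0 pr0 lnN kpr; have N0' : (0 : R) < N%:R by rewrite ltr0n.
rewrite exprS mulrCA -mulrA ger_pMr //.
have P0 : 0 < 4 * N%:R ^+ k.+1 * pr ^+ 'C(k.+2, 2).
  by rewrite !mulr_gt0 ?exprn_gt0.
rewrite -[leLHS]lnK ?posrE // -[leRHS]expR0 ler_expR.
rewrite !lnM ?posrE ?mulr_gt0 ?exprn_gt0 // !lnXn //.
rewrite -[ln N%:R *+ _]mulr_natl -[ln pr *+ _]mulr_natl.
have hh : 2 * ('C(k.+2, 2)%:R * ln pr) = k.+1%:R * (k.+2%:R * ln pr).
  by rewrite mulrA -natrM double_bin2 natrM; ring.
have l40 : 0 <= ln 4 :> R by apply: ln_ge0; lra.
have t1 : k.+1%:R * (k.+2%:R * ln pr) <= k.+1%:R * (- (2 * (n%:R * h)) - 2 * ln 4).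
  by rewrite ler_wpM2l.
have t2 : k.+1%:R * ln N%:R <= k.+1%:R * (n%:R * h) by rewrite ler_wpM2l.
have t3 : ln 4 <= k.+1%:R * ln 4 :> R by rewrite ler_peMl // ler1n.
move: hh t1 t2 t3; set u := 'C(_, _)%:R * _; set v : R := k.+1%:R; lra.
Qed.

(** As 4 S <= m, the term 2 s m is at most half of m^2, so d >= m^2 / (4 S) and pr d >= L m. Then (1
    - pr)^d <= e^(-L m), which beats N^m by a factor e^(2 m) >= 4. *)
Lemma expected_independent_sets_le (N s m d : nat) (S C L : R) :
  let pr := 4 * L * (S / C) in
  (0 < N)%N -> (0 < m)%N -> 0 < S -> 0 < L -> s%:R <= S -> 4 * S <= C -> C <= m%:R ->
  pr <= 1 -> ln N%:R + 2 <= L -> (m ^ 2 <= 2 * s * (d + m))%N ->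
  4 * N%:R ^+ m * (1 - pr) ^+ d <= 1.
Proof.
move=> pr N0 m0 S0 L0 sS SC Cm pr1 NL hd0; have C0 : 0 < C by lra.
have N0' : (0 : R) < N%:R by rewrite ltr0n.
have m1 : (1 : R) <= m%:R by rewrite ler1n.
have hd : m%:R ^+ 2 <= 2 * s%:R * (d%:R + m%:R) :> R.
  by rewrite -natrX -natrD -!natrM ler_nat.
have hd2 : m%:R ^+ 2 <= 2 * S * (d%:R + m%:R).
  by apply: (le_trans hd); rewrite ler_wpM2r ?addr_ge0 // ler_wpM2l.
have hd3 : m%:R ^+ 2 <= 4 * S * d%:R.
  have : 4 * S * m%:R <= m%:R ^+ 2 by rewrite expr2 ler_wpM2r //; lra.
  by lra.
have Lm : L * m%:R <= pr * d%:R.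
  have -> : pr * d%:R = L / C * (4 * S * d%:R).
    by rewrite /pr; field; rewrite gt_eqF.
  apply: (@le_trans _ _ (L / C * m%:R ^+ 2)); last first.
    by rewrite ler_wpM2l // divr_ge0 ?ltW.
  rewrite expr2 mulrA ler_wpM2r // mulrAC ler_pdivlMr //.
  by rewrite ler_wpM2l ?(ltW L0).
have pe : (1 - pr) ^+ d <= expR (- (pr * d%:R)).
  have -> : expR (- (pr * d%:R)) = expR (- pr) ^+ d by rewrite -expRM_natr mulNr.
  rewrite lerXn2r ?nnegrE ?expR_ge0 ?subr_ge0 //.
  exact: expR_ge1Dx.
have NE : N%:R ^+ m = expR (m%:R * ln N%:R) :> R by exact: exp_mul_ln.
apply: (@le_trans _ _ (4 * N%:R ^+ m * expR (- (pr * d%:R)))).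
  by rewrite ler_wpM2l // mulr_ge0 // exprn_ge0.
rewrite NE -[4](@lnK R) ?posrE // -!expRD -[leRHS]expR0 ler_expR.
have u1 : m%:R * (ln N%:R + 2) <= L * m%:R by rewrite mulrC ler_wpM2r.
have l42 : ln 4 <= 2 :> R.
  have -> : ln 4 = 2 * ln 2 :> R.
    by rewrite (_ : 4 = 2 ^+ 2) ?lnXn // ?mulr_natl // expr2; lra.
  have := @ln_le_sub1 R 2 ltac:(lra); lra.
by lra.
Qed.

Lemma natr_pred (n : nat) : (0 < n)%N -> n.-1%:R = n%:R - 1 :> R.
Proof. by case: n => // n _; rewrite -[n.+1%:R]natr1 addrK. Qed.

Lemma natr_pred_double (n : nat) : (0 < n)%N -> (2 * n).-1%:R = 2 * n%:R - 1 :> R.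
Proof. by move=> n0; rewrite natr_pred ?muln_gt0 // natrM. Qed.

(* 'C(n, 2q-1) >= 'C(n', 2q-1), where n' <= n is chosen so that 2q-1 is the mode
   of the binomial law of parameters n' and b. *)
Lemma ln_bin_near_ge (b l : R) (n q : nat) : 0 < b -> b < 1 / 2 -> 1 < l ->
  (0 < q)%N -> b * n%:R / (2 * l) < q%:R -> q%:R <= b * n%:R / 2 ->
  (n%:R * (2 - l) - 2) * entropy b - ln n.+1%:R - (ln (1 - b) - ln b)
  <= ln 'C(n, (2 * q).-1)%:R.
Proof.
move=> b0 b2 l1 q0 ql qu.
have q1 : (1 : R) <= q%:R by rewrite ler1n.
have h0 : 0 < entropy b by apply: entropy_gt0; lra.
have qR := natr_pred_double q q0.
(* Chosen so that (n'+1) b lies between 2q - 1 and 2q, the mode condition of [ln_bin_ge] for 2q -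
   1. *)
pose y := 2 * q%:R / b; pose n' := (Num.truncn y).-1.
have y2 : 4 <= y by rewrite /y ler_pdivlMr //; lra.
have yn : y <= n%:R by rewrite /y ler_pdivrMr //; lra.
have n'E : n'.+1 = Num.truncn y by rewrite /n' prednK // truncn_gt0; lra.
have /andP[y3 y4] := @truncn_itv R y ltac:(lra).
rewrite -n'E in y3 y4.
have yb : y * b = 2 * q%:R by rewrite /y divfK // gt_eqF.
have n'l : n%:R * (2 - l) - 2 <= n'%:R.
  have h1 : n%:R / l <= y.
    rewrite /y ler_pdivlMr // mulrAC; move: ql.
    rewrite ltr_pdivrMr; last by lra.
    by rewrite ler_pdivrMr; lra.
  (* 1 / l >= 2 - l amounts to (l - 1)^2 >= 0; the loss in n' is thus linear in l - 1. *)
  have h2 : n%:R * (2 - l) <= n%:R / l.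
    rewrite ler_wpM2l // -[leRHS]mul1r ler_pdivlMr; last by lra.
    by have := sqr_ge0 (l - 1); lra.
  by move: y4; rewrite -natr1 -natr1; lra.
clearbody n'; clear n'E.
have n'n : (n' <= n)%N by rewrite -(ler_nat R); move: y3; rewrite -natr1; lra.
have up : n'.+1%:R * b <= 2 * q%:R by rewrite -yb ler_wpM2r // ltW.
have lo : 2 * q%:R - 1 <= n'.+1%:R * b.
  have : y * b <= n'.+2%:R * b by rewrite ler_wpM2r // ltW.
  by rewrite yb -[n'.+2%:R]natr1; lra.
have qn2 : ((2 * q).-1 <= n')%N.
  rewrite -(ler_nat R) qR; move: lo up; rewrite -natr1; set u : R := n'%:R => lo up.
  have u0 : 0 <= u by rewrite /u.
  have : (u + 1) * b <= (u + 1) * (1 / 2) by rewrite ler_wpM2l //; lra.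
  by lra.
have := @ln_bin_ge R b n' (2 * q).-1 b0 b2 qn2.
rewrite qR => /(_ lo ltac:(lra)) lnN'.
have n'0 : (0 : R) < 'C(n', (2 * q).-1)%:R by rewrite ltr0n bin_gt0.
have NN' : ln 'C(n', (2 * q).-1)%:R <= ln 'C(n, (2 * q).-1)%:R :> R.
  by rewrite ler_ln ?posrE // ?ltr0n ?bin_gt0 ?(leq_trans qn2) // ler_nat leq_bin2l.
have ln' : ln n'.+1%:R <= ln n.+1%:R :> R by rewrite ler_ln ?posrE ?ltr0n // ler_nat.
have n'h : (n%:R * (2 - l) - 2) * entropy b <= n'%:R * entropy b.
  by rewrite ler_wpM2r // ltW.
set u := ln n'.+1%:R in ln' lnN'; set v := ln n.+1%:R in ln' *; lra.
Qed.

(** The edge probability is 4 (n+1) (entropy b + 2) (e^(entropy (b/2)) / c)^n, with logarithm lA +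
    ln (n+1) - n d. The three numerical bounds give in turn pr <= 1, 4 S <= C, and few cliques. The
    factor 4 in the conclusion is 2 from the deleted vertices and 2 from rounding c^n up to m. *)
Lemma clique_free_of_bounds (b c : R) (n p e k : nat) :
  let q := (p ^ e)%N in let d := ln c - entropy (b / 2) in
  let lA := ln (4 * (entropy b + 2)) in
  0 < b -> b < 1 / 2 -> 0 < c -> 0 < d -> prime p -> (0 < e)%N ->
  q%:R <= b * n%:R / 2 ->
  lA + ln n.+1%:R <= d * n%:R -> ln 4 <= d * n%:R ->
  k.+2%:R * (lA + ln n.+1%:R) + 2 * ln 4
    <= (k.+2%:R * d - 2 * entropy b) * n%:R ->
  exists G : graph 'rV[R]_n,
    [/\ distance_graph G, (clique_number R G < k.+2%:R%:E)%E &
      forall j, colorable G j ->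
        'C(n, (2 * q).-1)%:R <= 4 * c ^+ n * j%:R :> R].
Proof.
move=> q d lA b0 b2 c0 d0 pp e0 qu hm2 hm3 hm4.
set h0 := entropy (b / 2) in d d0 hm2 hm3 hm4; set h1 := entropy b in lA hm2 hm4.
have h00 : 0 < h0 by apply: entropy_gt0; lra.
have h10 : 0 < h1 by apply: entropy_gt0; lra.
have q0 : (0 < q)%N by rewrite expn_gt0 prime_gt0.
have q1 : (1 : R) <= q%:R by rewrite ler1n.
have qR := natr_pred_double q q0; have qR' := natr_pred q q0.
have n0 : (0 : R) <= n%:R by [].
have bn : b * n%:R <= 1 / 2 * n%:R by rewrite ler_wpM2r // ltW.
have qn : ((2 * q).-1 <= n)%N by rewrite -(ler_nat R) qR; lra.
have qn' : (q.-1 <= n)%N by rewrite -(ler_nat R) qR'; lra.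
set N := 'C(n, (2 * q).-1).
have N0 : (0 < N)%N by rewrite bin_gt0.
have s0' : (0 : R) < 'C(n, q.-1)%:R by rewrite ltr0n bin_gt0.
have lnN : ln N%:R <= n%:R * h1.
  by apply: ln_bin_le => //; [lra|rewrite qR; lra].
have lns : ln 'C(n, q.-1)%:R <= n%:R * h0.
  by apply: ln_bin_le => //; [lra|lra|rewrite qR'; lra].
clear qn qn' qR qR' bn q1 qu.
pose S : R := expR (n%:R * h0); pose C := c ^+ n.
have S0 : 0 < S by exact: expR_gt0.
have C0 : 0 < C by rewrite exprn_gt0.
have CE : C = expR (n%:R * ln c) by exact: exp_mul_ln.
have sS : 'C(n, q.-1)%:R <= S.
  by rewrite -[leLHS]lnK ?posrE // ler_expR.
have C1 : 1 <= C by rewrite CE -expR0 ler_expR mulr_ge0 //; rewrite /d in d0; lra.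
have SC4 : 4 * S <= C.
  rewrite -[4](@lnK R) ?posrE // CE -expRD ler_expR.
  by rewrite /d in hm3; lra.
set m := (Num.truncn C).+1.
have mC : C <= m%:R by exact/ltW/truncnS_gt.
have mC2 : m%:R <= 2 * C.
  have : (Num.truncn C)%:R <= C by rewrite truncn_le ltW.
  by rewrite /m -natr1; lra.
have m0 : (0 < m)%N by [].
clearbody m.
pose L := n.+1%:R * (h1 + 2); have L0 : 0 < L by rewrite mulr_gt0 ?ltr0n //; lra.
pose pr := 4 * L * (S / C).
have pr0 : 0 < pr by rewrite /pr mulr_gt0 ?divr_gt0 // mulr_gt0.
have lnpr : ln pr = lA + ln n.+1%:R - n%:R * d.
  have A0 : 0 < h1 + 2 by lra.
  rewrite /pr CE -expRB /L !lnM ?posrE ?mulr_gt0 ?expR_gt0 ?ltr0n //.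
  by rewrite expRK /lA lnM ?posrE // /d; ring.
have pr1 : pr <= 1.
  by rewrite -[leLHS]lnK ?posrE // -[leRHS]expR0 ler_expR lnpr; lra.
have hX : 4 * N%:R ^+ k.+2 * pr ^+ 'C(k.+2, 2) <= N%:R.
  by apply: (expected_cliques_le N k n h1) => //; rewrite lnpr; lra.
have NL : ln N%:R + 2 <= L by rewrite /L -natr1; nra.
have [G [dG cG colG]] := @clique_free_distance_graph R n p e k.+1 m pr pp e0
  m0 ltac:(by rewrite ltW) N0 hX
  (fun d' => expected_independent_sets_le N _ m d' S C L N0 m0 S0 L0 sS SC4 mC pr1 NL).
exists G; split=> // j /colG jN.
have : N%:R <= 2 * (j%:R * m%:R) :> R by rewrite -!natrM ler_nat.
move=> /le_trans; apply.
rewrite -/C; have : j%:R * m%:R <= j%:R * (2 * C) by rewrite ler_wpM2l.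
by lra.
Qed.

Lemma clique_free_large_dimension (b c z : R) (k : nat) :
  0 < b -> b < 1 / 2 -> 0 < z -> 0 < c ->
  entropy (b / 2) < ln c ->
  2 * entropy b < k.+2%:R * (ln c - entropy (b / 2)) ->
  ln z + ln c < entropy b ->
  exists n0 : nat, forall n, (n0 <= n)%N -> exists G : graph 'rV[R]_n,
    [/\ distance_graph G, (clique_number R G < k.+2%:R%:E)%E &
        ((z ^+ n)%:E <= chromatic_number R G)%E].
Proof.
move=> b0 b2 z0 c0; set h0 := entropy (b / 2); set h1 := entropy b.
set d := ln c - h0 => hc hk hz.
have h10 : 0 < h1 by apply: entropy_gt0; lra.
have d0 : 0 < d by rewrite /d; lra.
pose D := k.+2%:R * d - 2 * h1; have D0 : 0 < D by rewrite /D; lra.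
pose g := h1 - ln z - ln c; have g0 : 0 < g by rewrite /g; lra.
(* The slack g is halved: a q too small by a factor l costs n (l - 1) h1 = n g / 2 in the number of
   vertices, and the other half absorbs ln (n+1) and the constants in c5. *)
pose l := 1 + g / (2 * h1).
have gh0 : 0 < g / (2 * h1) by rewrite divr_gt0 //; lra.
have l1 : 1 < l by rewrite /l; lra.
have lg : (l - 1) * h1 = g / 2 by rewrite /l; field; rewrite gt_eqF.
clearbody l; clear gh0.
pose lA := ln (4 * (h1 + 2)).
pose c5 := 2 * h1 + ln 4 + (ln (1 - b) - ln b).
have g20 : 0 < g / 2 by rewrite divr_gt0.
have [m1 hm1] := prime_power_near b l b0 l1.
have [m2 hm2] := @ln_growth R d 1 lA d0 ler01.
have [m3 hm3] := @ln_growth R d 0 (ln 4) d0 (lexx _).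
have [m4 hm4] := @ln_growth R D k.+2%:R (k.+2%:R * lA + 2 * ln 4) D0 (ler0n _ _).
have [m5 hm5] := @ln_growth R (g / 2) 1 c5 g20 ler01.
exists (m1 + m2 + m3 + m4 + m5)%N => n nn.
have [n1 [n2 [n3 [n4 n5]]]] :
    (m1 <= n /\ m2 <= n /\ m3 <= n /\ m4 <= n /\ m5 <= n)%N by clear -nn; lia.
have {hm1 n1}[p [e [pp e0 ql qu]]] := hm1 n n1.
have {hm2 n2} hm2 := hm2 n n2; have {hm3 n3} hm3 := hm3 n n3.
have {hm4 n4} hm4 := hm4 n n4; have {hm5 n5} hm5 := hm5 n n5.
clear nn m1 m2 m3 m4 m5.
have := clique_free_of_bounds b c n p e k b0 b2 c0 d0 pp e0 qu.
rewrite /= -/h1 -/h0 -/d -/lA -/D => G0.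
have {G0}[|||G [dG cG colG]] := G0.
- by rewrite addrC -[ln n.+1%:R]mul1r.
- by move: hm3; rewrite mul0r add0r.
- by move: hm4; rewrite addrA -mulrDr [_ + lA]addrC.
exists G; split=> //; apply: chromatic_number_ge => j /colG; clear hm2 hm3 hm4 colG.
have q0 : (0 < p ^ e)%N by rewrite expn_gt0 prime_gt0.
have := ln_bin_near_ge b l n (p ^ e) b0 b2 l1 q0 ql qu; rewrite -/h1.
have qn : ((2 * p ^ e).-1 <= n)%N.
  rewrite -(ler_nat R) natr_pred_double //.
  have : b * n%:R <= 1 / 2 * n%:R by rewrite ler_wpM2r // ltW.
  have : (0 : R) <= n%:R by [].
  by move: qu; set qq := _%:R; lra.
set N : R := 'C(_, _)%:R => lnN Nj.
have N0 : 0 < N by rewrite ltr0n bin_gt0.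
have C0 : 0 < 4 * c ^+ n by rewrite mulr_gt0 ?exprn_gt0.
rewrite -(ler_pM2l C0); apply: le_trans Nj.
rewrite -[leRHS]lnK ?posrE // !exp_mul_ln // -[4](@lnK R) ?posrE //.
rewrite -!expRD ler_expR; apply: le_trans lnN.
have nlg : n%:R * ((l - 1) * h1) = n%:R * (g / 2) by rewrite lg.
rewrite /g in nlg hm5; rewrite /c5 in hm5; lra.
Qed.

End LargeDimension.

(** * Passage to the supremum and the infimum *)

Local Open Scope classical_set_scope.

(** Below n0 take delta n = 1 - z, so that the required chromatic number is 1 and a single vertex
    suffices; from n0 on take delta n = 0. *)
Lemma zeta_clique_ge (R : realType) (k : nat) (z : R) (n0 : nat) :
  (forall n, (n0 <= n)%N -> exists G : graph 'rV[R]_n,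
    [/\ distance_graph G, (clique_number R G < k.+2%:R%:E)%E &
        ((z ^+ n)%:E <= chromatic_number R G)%E]) ->
  (z%:E <= zeta_clique R k.+2)%E.
Proof.
move=> h; apply: ereal_sup_ubound; exists z => //.
exists (fun n => if (n0 <= n)%N then 0 else 1 - z); split.
  apply: cvg_near_cst; exists n0 => // n /= n0n.
  by rewrite n0n.
move=> n; case: ifP => nn; first by rewrite addr0; exact: h.
have [G [dG cG oneG]] := one_vertex_graph R n k.
by exists G; split=> //; rewrite addrC subrK expr1n.
Qed.

Theorem theorem6 (R : realType) (k : int) (b0 : R)
  (hk : 5 <= k) (hb0 : 0 < b0 < 1 / 2) :
  ((tau1 b0 / c_opt k b0)%:E <= zeta_clique R k)%E.
Proof.
case: k hk => [[|[|k]]|] // _; have /andP[b1 b2] := hb0.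
have b01 : 0 < b0 < 1 by lra.
have t0 := tau0_gt0 b0 b01; have t1 := tau1_gt0 b0 b01.
have lt0 := ln_tau0 b0 b01; have lt1 := ln_tau1 b0 b01.
rewrite /c_opt; case: asboolP => [[c1 Sc1]|_]; last first.
  (* With no admissible c' the bound is [tau1] / [tau1] = 1, reached by one vertex in every
     dimension. *)
  rewrite divff ?gt_eqF //; apply: (@zeta_clique_ge R k 1 0%N) => n _.
  by rewrite expr1n; exact: one_vertex_graph.
set S := c_set _ _ in Sc1 *; set c := inf S.
have lbS : lbound S (tau0 b0) by move=> x [/andP[]].
have infS : has_inf S by split; [exists c1|exists (tau0 b0)].
have c0 : 0 < c.
  by apply: (lt_le_trans t0); apply: lb_le_inf => //; exists c1.
have tc0 : 0 < tau1 b0 / c by rewrite divr_gt0.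
(* If the supremum were below the bound, a midpoint between its nonnegative part and the bound would
   be a z contradicting [main]. *)
suff main z : 0 < z -> z < tau1 b0 / c -> (z%:E <= zeta_clique R k.+2)%E.
  rewrite leNgt; apply/negP => lt.
  have : exists2 r, r < tau1 b0 / c & (zeta_clique R k.+2 <= r%:E)%E.
    move: lt; case: (zeta_clique _ _) => [r| |] //; first by exists r.
    by move=> _; exists 0 => //; rewrite leNye.
  move=> [r rt zr]; pose m := Num.max 0 r.
  have m0 : 0 <= m by rewrite le_max lexx.
  have mt : m < tau1 b0 / c by rewrite gt_max tc0 rt.
  have mr : r <= m by rewrite le_max lexx orbT.
  have := main ((m + tau1 b0 / c) / 2) ltac:(lra) ltac:(lra).
  by move=> /le_trans/(_ zr); rewrite lee_fin; lra.
move=> z0 zt; have {}zt : c < tau1 b0 / z.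
  by move: zt; rewrite !ltr_pdivlMr // mulrC.
(* Members of [c_set] satisfy the condition on k only weakly, and the infimum need not be attained.
   Some member x lies below c', and moving from x to c' makes the condition strict, while z c' <
   [tau1] still holds. *)
pose c' := (c + tau1 b0 / z) / 2.
have cc' : c < c' by rewrite /c'; lra.
have c't : c' < tau1 b0 / z by rewrite /c'; lra.
have [x [/andP[x0 _] xne xk] xc'] := inf_lt infS.1 cc'.
have xpos : 0 < x by apply: lt_le_trans x0.
have c'0 : 0 < c' by lra.
have lx : 0 < ln x - ln (tau0 b0).
  by rewrite lt_neqAle eq_sym xne subr_ge0 ler_ln ?posrE.
have lxc : ln x < ln c' by rewrite ltr_ln ?posrE.
have [n0 hn0] : exists n0 : nat, forall n, (n0 <= n)%N -> exists G : graph 'rV[R]_n,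
    [/\ distance_graph G, (clique_number R G < k.+2%:R%:E)%E &
        ((z ^+ n)%:E <= chromatic_number R G)%E].
  apply: (@clique_free_large_dimension R b0 c') => //.
  - by rewrite -lt0; lra.
  - rewrite -lt0 -lt1.
    have : 2 * ln (tau1 b0) / (ln x - ln (tau0 b0)) <= k.+2%:R.
      by apply: (le_trans (Num.Theory.ceil_ge _)); rewrite -[k.+2%:R]/(k.+2%:~R) ler_int.
    rewrite ler_pdivrMr // => /le_lt_trans; apply.
    by rewrite ltr_pM2l ?ltr0n //; lra.
  have zc : z * c' < tau1 b0 by rewrite mulrC -ltr_pdivlMr.
  rewrite -lt1 -[ltLHS]lnM ?posrE //.
  by rewrite (@ltr_ln R (z * c') (tau1 b0)) ?posrE //; exact: mulr_gt0.
exact: zeta_clique_ge hn0.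
Qed.
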